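(* Let $\mu$ be a macro state and $B$ any operator on $\mathcal{H}$, and let $w_{\mu B}(t):=\frac1{d_\mu}\operatorname{tr}\bigl[P_\mu e^{iHt}Be^{-iHt}\bigr]$. Then: (i) for every $t\in\mathbb{R}$ and every $\varepsilon>0$, for $(1-\varepsilon)$-most $\psi_0\in\mathbb{S}(\mathcal{H}_\mu)$, $$\bigl|\langle\psi_t|B|\psi_t\rangle-w_{\mu B}(t)\bigr|\le\min\Bigl\{\frac{\|B\|}{\sqrt{\varepsilon d_\mu}},\ \sqrt{\frac{\|B\|\operatorname{tr}|B|}{\varepsilon d_\mu^2}},\ \sqrt{\frac{18\pi^3\log(4/\varepsilon)}{d_\mu}}\,\|B\|\Bigr\};$$ (ii) for every $T>0$ and $\varepsilon>0$, for $(1-\varepsilon)$-most $\psi_0\in\mathbb{S}(\mathcal{H}_\mu)$, $$\frac1T\int_0^T\bigl|\langle\psi_t|B|\psi_t\rangle-w_{\mu B}(t)\bigr|^2dt\le\frac{\|B\|^2}{\varepsilon d_\mu}.$$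
   Context: $\mathcal{H}$ is a finite-dimensional complex Hilbert space with an orthogonal decomposition $\mathcal{H}=\bigoplus_\nu\mathcal{H}_\nu$ into nonzero subspaces (macro spaces); $P_\mu$ is the orthogonal projection onto $\mathcal{H}_\mu$, $d_\mu=\dim\mathcal{H}_\mu$. $H$ is self-adjoint on $\mathcal{H}$, $\psi_t=e^{-iHt}\psi_0$. $\|B\|$ is the operator norm, $|B|=(B^\dagger B)^{1/2}$. $u_\mu$ is the normalized uniform measure on the unit sphere $\mathbb{S}(\mathcal{H}_\mu)$; ''$s(\psi)$ holds for $(1-\varepsilon)$-most $\psi$'' means $u_\mu(\{\psi:s(\psi)\})\ge1-\varepsilon$. *)

(* Defs.v *)
From HB Require Import structures.
From mathcomp Require Import all_boot all_order all_algebra.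
From mathcomp Require Import all_classical all_reals all_analysis.
From mathcomp Require Import complex.
Set Implicit Arguments. Unset Strict Implicit. Unset Printing Implicit Defensive.
Import Order.TTheory GRing.Theory Num.Theory.
Import numFieldNormedType.Exports.
Local Open Scope ring_scope.
Local Open Scope classical_set_scope.

(* The Hilbert space H is C^n = 'cV[R[i]]_n with the standard inner product. *)

Definition adjmx (R : realType) (m k : nat) (A : 'M[R[i]]_(m, k)) : 'M[R[i]]_(k, m) :=
  (map_mx Num.conj A)^T.

Definition dotc (R : realType) (n : nat) (u v : 'cV[R[i]]_n) : R[i] :=
  (adjmx u *m v) 0 0.

Definition cabs (R : realType) (z : R[i]) : R :=
  Num.sqrt (complex.Re z ^+ 2 + complex.Im z ^+ 2).

Definition vnorm (R : realType) (n : nat) (v : 'cV[R[i]]_n) : R :=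
  Num.sqrt (complex.Re (dotc v v)).

Definition opnorm (R : realType) (n : nat) (B : 'M[R[i]]_n) : R :=
  sup [set vnorm (B *m psi) | psi in [set psi : 'cV[R[i]]_n | vnorm psi = 1]].

Definition psd (R : realType) (n : nat) (S : 'M[R[i]]_n) : Prop :=
  adjmx S = S /\ forall v : 'cV[R[i]]_n, 0 <= dotc v (S *m v).

(** |B| = (B^dagger B)^(1/2): the (unique) positive semidefinite square root of B^dagger B. *)
Definition absmx (R : realType) (n : nat) (B : 'M[R[i]]_n) : 'M[R[i]]_n :=
  xget 0 [set S : 'M[R[i]]_n | psd S /\ S *m S = adjmx B *m B].

Definition trnorm (R : realType) (n : nat) (B : 'M[R[i]]_n) : R :=
  complex.Re (\tr (absmx B)).

Definition expmx_psum (R : realType) (n : nat) (A : 'M[R[i]]_n) (m : nat) : 'M[R[i]]_n :=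
  \sum_(k < m) (k`!%:R)^-1 *: A ^+ k.

Definition expmx (R : realType) (n : nat) (A : 'M[R[i]]_n) : 'M[R[i]]_n :=
  \matrix_(i, j)
    Complex (limn ((fun m => complex.Re (expmx_psum A m i j)) : R^nat))
            (limn ((fun m => complex.Im (expmx_psum A m i j)) : R^nat)).

Definition evol (R : realType) (n : nat) (H : 'M[R[i]]_n) (t : R) : 'M[R[i]]_n :=
  expmx (Complex 0 (- t) *: H).

Definition selfadjoint (R : realType) (n : nat) (H : 'M[R[i]]_n) : Prop :=
  adjmx H = H.

Definition unitarymx (R : realType) (n : nat) (U : 'M[R[i]]_n) : Prop :=
  adjmx U *m U = 1%:M.

Definition orthoproj (R : realType) (n : nat) (P : 'M[R[i]]_n) : Prop :=
  adjmx P = P /\ P *m P = P.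

Definition wmuB (R : realType) (n : nat) (P H B : 'M[R[i]]_n) (t : R) : R[i] :=
  ((\rank P)%:R)^-1 * \tr (P *m evol H (- t) *m B *m evol H t).

Definition dev (R : realType) (n : nat) (P H B : 'M[R[i]]_n) (psi0 : 'cV[R[i]]_n) (t : R) : R :=
  let psit := evol H t *m psi0 in
  cabs (dotc psit (B *m psit) - wmuB P H B t).

(** Measurable structure on C^n: the Borel sigma-algebra, generated by the
    preimages of Borel sets of R under the real and imaginary parts of the
    coordinates. *)
Definition pcvec (R : realType) (n : nat) := 'cV[R[i]]_n.
HB.instance Definition _ (R : realType) (n : nat) := Choice.on (pcvec R n).
HB.instance Definition _ (R : realType) (n : nat) := isPointed.Build (pcvec R n) 0.

Definition cvec_gen (R : realType) (n : nat) : set (set (pcvec R n)) :=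
  [set S | exists (j : 'I_n) (b : bool) (A : set R), measurable A /\
     S = (fun v : 'cV[R[i]]_n =>
            if b then complex.Re (v j 0) else complex.Im (v j 0)) @^-1` A].

Definition CV (R : realType) (n : nat) := g_sigma_algebraType (@cvec_gen R n).

Definition sphere (R : realType) (n : nat) (P : 'M[R[i]]_n) : set 'cV[R[i]]_n :=
  [set psi | P *m psi = psi /\ dotc psi psi = 1].

(** u is the normalized uniform measure on S(H_mu): a Borel probability measure on
    C^n concentrated on S(H_mu) and invariant under every unitary of H leaving H_mu
    invariant (i.e. commuting with P); these restrict to all unitaries of H_mu, and
    the normalized uniform measure is the unique such measure. *)
Definition uniform_on_sphere (R : realType) (n : nat) (P : 'M[R[i]]_n)
    (u : probability (CV R n) R) : Prop :=
  u (sphere P) = 1%E /\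
  forall U : 'M[R[i]]_n, unitarymx U -> U *m P = P *m U ->
    forall A : set (CV R n), measurable A ->
      u ((fun psi : 'cV[R[i]]_n => U *m psi) @^-1` A) = u A.

(* Main.v *)
(** For a Hermitian [A] on the range of [P], written in an eigenbasis, the
    quadratic form is [f = sum_j l_j w_j] with [w_j = |<e_j, psi>|^2].  Composing
    with a small rotation of a random coordinate plane [(i, j)], with a phase
    taken from [{1, -1, i, -i}], gives an exchangeable pair of points of the
    sphere for which [f - mean f] is an eigenvector of the averaged difference.
    As in Stein's method this yields
    [E f^(2m+2) <= (2m+1) c E f^(2m)] for the centred form, with [c] of order
    [|A|^2 / d]: letting the angle tend to [0], the case [m = 0] is the variance
    bound [tr (A^2) / d^2], and summing the moments yields a Gaussian tail.  The
    constant obtained this way is better than [18 pi^3], so Levy's lemma is not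
    needed.  A general operator is split into its Hermitian and
    skew-Hermitian parts, and the bound for the time average follows from the
    variance bound by Tonelli's theorem and Markov's inequality. *)

Require Import Defs.
From HB Require Import structures.
From mathcomp Require Import all_boot all_order all_algebra.
From mathcomp Require Import all_classical all_reals all_analysis.
From mathcomp Require Import measurable_realfun.
From mathcomp Require Import complex.
From mathcomp Require Import ring lra.
Import Order.TTheory GRing.Theory Num.Theory.
Import numFieldNormedType.Exports.
Local Open Scope ring_scope.
Local Open Scope classical_set_scope.
Local Open Scope complex_scope.
Set Implicit Arguments. Unset Strict Implicit. Unset Printing Implicit Defensive.

(** * Adjoints and simultaneous diagonalization *)

(** The uniform measure is known only through its invariance, so every expectation must come from
    explicit unitaries that commute with [P]. The four phases make the computation close in the
    weights: terms linear in the interference [conj y_i * y_j] cancel, and its square contributes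
    [w_i * w_j]. With [r] the squared sine of the angle, the drift has rate [8 r d], while the
    squared increments have a part of order [r^2], estimated crudely by the norm, and a part of
    order [r], a variance under the weights. As [r] tends to 0 the crude part disappears, which the
    sharp second moment needs; for the tail [r = 1/d] is good enough. The minimum in (i) does not
    depend on [psi0], so it is one of the three numbers: each bound is proved alone with the full
    [eps], without a union bound. The 4 in [log (4 / eps)] is two Hermitian parts times the factor 2
    of each tail. *)

Lemma conjE (R : realType) (z : R[i]) : Num.conj z = conjc z.
Proof. by []. Qed.

Definition csq (R : realType) (z : R[i]) : R := complex.Re z ^+ 2 + complex.Im z ^+ 2.

Lemma csqE (R : realType) (z : R[i]) : Num.conj z * z = (csq z)%:C.
Proof. by rewrite conjE; case: z => a b; apply/eqP; rewrite eq_complex /csq /=; apply/andP; split; apply/eqP; ring. Qed.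

Lemma csq_ge0 (R : realType) (z : R[i]) : 0 <= csq z.
Proof. by rewrite addr_ge0 // sqr_ge0. Qed.

Lemma csqJ (R : realType) (z : R[i]) : csq (Num.conj z) = csq z.
Proof. by rewrite conjE; case: z => a b; rewrite /csq /= sqrrN. Qed.

Lemma cabsE (R : realType) (z : R[i]) : cabs z ^+ 2 = csq z.
Proof. by rewrite /cabs sqr_sqrtr // csq_ge0. Qed.

Lemma ReM (R : realType) (a b : R[i]) :
  complex.Re (a * b) = complex.Re a * complex.Re b - complex.Im a * complex.Im b.
Proof. by case: a b => [? ?] [? ?]. Qed.

Lemma ImM (R : realType) (a b : R[i]) :
  complex.Im (a * b) = complex.Re a * complex.Im b + complex.Im a * complex.Re b.
Proof. by case: a b => [? ?] [? ?]. Qed.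

Section Adjoint.
Variable R : realType.
Implicit Types m k n : nat.

Lemma adjmxE m k (A : 'M[R[i]]_(m, k)) i j : adjmx A i j = Num.conj (A j i).
Proof. by rewrite !mxE. Qed.

Lemma adjmxK m k (A : 'M[R[i]]_(m, k)) : adjmx (adjmx A) = A.
Proof. by apply/matrixP => i j; rewrite !adjmxE conjCK. Qed.

Lemma adjmxM m k n (A : 'M[R[i]]_(m, k)) (B : 'M[R[i]]_(k, n)) :
  adjmx (A *m B) = adjmx B *m adjmx A.
Proof. by rewrite /adjmx map_mxM trmx_mul. Qed.

Lemma adjmxD m k (A B : 'M[R[i]]_(m, k)) : adjmx (A + B) = adjmx A + adjmx B.
Proof. by rewrite /adjmx map_mxD linearD. Qed.

Lemma adjmxZ m k a (A : 'M[R[i]]_(m, k)) : adjmx (a *: A) = Num.conj a *: adjmx A.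
Proof. by rewrite /adjmx map_mxZ linearZ. Qed.

Lemma adjmx1 n : adjmx (1%:M : 'M[R[i]]_n) = 1%:M.
Proof. by rewrite /adjmx map_mx1 trmx1. Qed.

Lemma dotcE n (x y : 'cV[R[i]]_n) : dotc x y = \sum_k Num.conj (x k 0) * y k 0.
Proof. by rewrite /dotc mxE; apply: eq_bigr => k _; rewrite adjmxE. Qed.

Lemma dotc_sqr n (x : 'cV[R[i]]_n) : dotc x x = (\sum_k csq (x k 0))%:C.
Proof. by rewrite dotcE rmorph_sum; apply: eq_bigr => k _; exact: csqE. Qed.

Lemma dotc_adj n (A : 'M[R[i]]_n) x y : dotc x (A *m y) = dotc (adjmx A *m x) y.
Proof. by rewrite /dotc adjmxM adjmxK mulmxA. Qed.

Lemma dotcDr n (x y z : 'cV[R[i]]_n) : dotc x (y + z) = dotc x y + dotc x z.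
Proof. by rewrite /dotc mulmxDr mxE. Qed.

Lemma dotcZr n a (x y : 'cV[R[i]]_n) : dotc x (a *: y) = a * dotc x y.
Proof. by rewrite /dotc -scalemxAr mxE. Qed.

(** One unitary triangularizes two commuting matrices; a Hermitian matrix in triangular form equals
    its adjoint, hence is diagonal with real entries. *)
Lemma codiag n (A P : 'M[R[i]]_n) :
  adjmx A = A -> adjmx P = P -> A *m P = P *m A ->
  exists (V : 'M[R[i]]_n) (l k : 'I_n -> R),
    [/\ V *m adjmx V = 1%:M, adjmx V *m V = 1%:M,
        A = adjmx V *m diag_mx (\row_i (l i)%:C) *m V &
        P = adjmx V *m diag_mx (\row_i (k i)%:C) *m V].
Proof.
move=> hA hP /cotrigonalization2[V Vu /andP[tA tP]].
have adjE m (M : 'M[R[i]]_m) : (map_mx Num.conj M^T) = adjmx M by rewrite -map_trmx.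
have VV : V *m adjmx V = 1%:M by rewrite -adjE; exact/spectral.unitarymxP.
have VV' := mulmx1C VV.
have diag (M : 'M[R[i]]_n) : adjmx M = M -> is_trig_mx (conjmx V M) ->
    exists l : 'I_n -> R, M = adjmx V *m diag_mx (\row_i (l i)%:C) *m V.
  move=> hM; rewrite conjymx // adjE => /is_trig_mxP tM.
  set D := V *m M *m adjmx V in tM.
  have hD : adjmx D = D by rewrite /D !adjmxM adjmxK hM mulmxA.
  exists (fun i => complex.Re (D i i)).
  suff <- : D = diag_mx (\row_i (complex.Re (D i i))%:C).
    by rewrite /D !mulmxA VV' mul1mx -mulmxA VV' mulmx1.
  clearbody D; apply/matrixP => i j; rewrite !mxE.
  have [<-|nij] := eqVneq i j.
    rewrite mulr1n; have /(congr1 (fun M : 'M[R[i]]_n => M i i)) := hD.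
    rewrite adjmxE conjE; case: (D i i) => a b /= [] hb.
    by have -> : b = 0 by lra.
  rewrite mulr0n; move: nij; rewrite neq_lt => /orP[|] h; first exact: tM.
  by rewrite -hD adjmxE tM // conjC0.
have [l hl] := diag _ hA tA; have [k hk] := diag _ hP tP.
by exists V, l, k.
Qed.

End Adjoint.

(** * Eigenbases adapted to a projection *)

Section Frame.
Variables (R : realType) (n : nat).
Implicit Types (A P V : 'M[R[i]]_n) (x : 'cV[R[i]]_n).

(** In the full rank factorization [P = C *m D], idempotency forces [D *m C = 1%:M], an identity of
    size [\rank P] with the same trace as [P]. *)
Lemma trace_idempotent P : P *m P = P -> \tr P = (\rank P)%:R.
Proof.
move: (mulmx_base P) (row_base_free P) (col_base_full P).
move: (col_base P) (row_base P) => C D CD Df Cf PP.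
have DC : D *m C = 1%:M.
  apply: (row_free_inj Df); apply: (row_full_inj Cf).
  by rewrite mul1mx mulmxA mulmxA CD -mulmxA CD.
by have := mxtrace_mulC C D; rewrite CD DC mxtrace1.
Qed.

Definition rdiag (l : 'I_n -> R) : 'M[R[i]]_n := diag_mx (\row_i (l i)%:C).

Lemma rdiag_mul l k : rdiag l *m rdiag k = rdiag (fun i => l i * k i).
Proof.
rewrite /rdiag mulmx_diag; congr diag_mx; apply/rowP => i; rewrite !mxE.
by rewrite -rmorphM.
Qed.

Lemma rdiag_inj l k : rdiag l = rdiag k -> l =1 k.
Proof.
by move=> h i; have /(congr1 (fun M : 'M[R[i]]_n => M i i)) := h; rewrite !mxE !eqxx !mulr1n => -[].
Qed.

Definition weight V (j : 'I_n) x : R := csq ((V *m x) j 0).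

Lemma weight_ge0 V j x : 0 <= weight V j x. Proof. exact: csq_ge0. Qed.

Lemma dotc_rdiag V l x :
  dotc x (adjmx V *m rdiag l *m V *m x) = (\sum_j l j * weight V j x)%:C.
Proof.
rewrite -!mulmxA dotc_adj adjmxK /weight; move: (V *m x) => y.
rewrite dotcE rmorph_sum; apply: eq_bigr => j _.
by rewrite mul_diag_mx !mxE mulrCA csqE -rmorphM.
Qed.

Lemma trace_rdiag V l : V *m adjmx V = 1%:M ->
  \tr (adjmx V *m rdiag l *m V) = (\sum_j l j)%:C.
Proof.
move=> VV; rewrite -mulmxA mxtrace_mulC -mulmxA VV mulmx1 mxtrace_diag rmorph_sum.
by apply: eq_bigr => j _; rewrite mxE.
Qed.

Lemma weight_sum V x : adjmx V *m V = 1%:M -> dotc x x = (\sum_j weight V j x)%:C.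
Proof.
move=> VV; have := dotc_rdiag V (fun=> 1) x.
have -> : rdiag (fun=> 1) = 1%:M.
  by apply/matrixP => i j; rewrite !mxE.
rewrite mulmx1 VV mul1mx => ->.
by congr (_%:C); apply: eq_bigr => j _; rewrite mul1r.
Qed.

(** Taking adjoints in [A *m P = A] gives [P *m A = A], so [A] and [P] share an eigenbasis. [J]
    collects the eigenvalues 1 of [P]; its vectors span the macro space, and [A] vanishes on the
    others. *)
Lemma projection_frame A P : adjmx A = A -> orthoproj P -> A *m P = A ->
  exists (V : 'M[R[i]]_n) (l : 'I_n -> R) (J : {set 'I_n}),
    [/\ V *m adjmx V = 1%:M /\ adjmx V *m V = 1%:M,
        A = adjmx V *m rdiag l *m V,
        P = adjmx V *m rdiag (fun j => (j \in J)%:R) *m V,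
        #|J| = \rank P &
        forall j, j \notin J -> l j = 0].
Proof.
move=> hA [hP PP] AP.
have PA : P *m A = A by rewrite -{1}hA -hP -adjmxM AP hA.
have [|V [l [k [VV VV' EA EP]]]] := @codiag R n A P hA hP; first by rewrite PA.
rewrite -!/(rdiag _) in EA EP.
have prod l1 l2 : adjmx V *m rdiag l1 *m V *m (adjmx V *m rdiag l2 *m V) =
    adjmx V *m rdiag (fun i => l1 i * l2 i) *m V.
  by rewrite !mulmxA -[_ *m V *m adjmx V]mulmxA VV mulmx1 -[_ *m _ *m rdiag l2]mulmxA rdiag_mul.
have inj l1 l2 : adjmx V *m rdiag l1 *m V = adjmx V *m rdiag l2 *m V -> l1 =1 l2.
  move=> h; apply: rdiag_inj.
  have := congr1 (fun M => V *m M *m adjmx V) h.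
  by rewrite !mulmxA VV !mul1mx -!mulmxA VV !mulmx1.
have kk j : k j * k j = k j by move: PP; rewrite EP prod => /inj.
have lk j : l j * k j = l j by move: AP; rewrite {1}EA EP prod {1}EA => /inj.
have k01 j : k j = (k j == 1)%:R.
  have [->//|k1] := eqVneq (k j) 1; apply/eqP.
  have /eqP : k j * (k j - 1) = 0 by rewrite mulrBr kk mulr1 subrr.
  by rewrite mulf_eq0 subr_eq0 (negbTE k1) orbF.
exists V, l, [set j | k j == 1]%SET; split => //.
- by rewrite EP; congr (_ *m rdiag _ *m _); apply/funext => j; rewrite inE -k01.
- have := trace_idempotent PP; rewrite {1}EP trace_rdiag // => /(congr1 (@complex.Re R)) /=.
  rewrite -(rmorph_nat (real_complex R)) /= => h.
  apply/eqP; rewrite -(eqr_nat R) -h; apply/eqP.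
  rewrite -sum1_card natr_sum big_mkcond /=; apply: eq_bigr => j _.
  by rewrite inE [RHS]k01; case: eqP.
- by move=> j; rewrite inE -lk => /negbTE kj; rewrite (k01 j) kj mulr0.
Qed.

End Frame.

(** * Givens rotations in a unitary frame *)

Section Givens.
Variables (R : realType) (n : nat).
Implicit Types (P V : 'M[R[i]]_n) (x : 'cV[R[i]]_n) (c : R) (z : R[i]).

(** A plane rotation with cosine [c] and complex sine [z], unitary when [c ^+ 2 + csq z = 1];
    replacing [z] by [- z] inverts it. *)
Definition givens (i j : 'I_n) c z : 'M[R[i]]_n := \matrix_(a, b)
  if a == i then (if b == i then c%:C else if b == j then z else 0)
  else if a == j then (if b == i then - Num.conj z else if b == j then c%:C else 0)
  else (a == b)%:R.

Lemma givensE i j c z x a : i != j -> (givens i j c z *m x) a 0 =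
  if a == i then c%:C * x i 0 + z * x j 0
  else if a == j then - Num.conj z * x i 0 + c%:C * x j 0 else x a 0.
Proof.
move=> ij; have ji : (j == i) = false by rewrite eq_sym (negbTE ij).
rewrite mxE.
have [ai|nai] := eqVneq a i.
  rewrite (bigD1 i) //= (bigD1 j) //= ?ji // big1 => [|b /andP[/negbTE bi /negbTE bj]].
    by rewrite !mxE ai !eqxx ji addr0.
  by rewrite mxE ai eqxx bi bj mul0r.
have [aj|naj] := eqVneq a j.
  rewrite (bigD1 i) //= (bigD1 j) //= ?ji // big1 => [|b /andP[/negbTE bi /negbTE bj]].
    by rewrite !mxE aj !eqxx ji addr0.
  by rewrite mxE aj ji eqxx bi bj mul0r.
rewrite (bigD1 a) //= big1 => [|b /negbTE ba].
  by rewrite mxE (negbTE nai) (negbTE naj) eqxx mul1r addr0.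
by rewrite mxE (negbTE nai) (negbTE naj) eq_sym ba mul0r.
Qed.

Lemma adjmx_givens i j c z : i != j -> adjmx (givens i j c z) = givens i j c (- z).
Proof.
move=> ij; have ji : (j == i) = false by rewrite eq_sym (negbTE ij).
have cc : Num.conj c%:C = c%:C by rewrite conjE conjc_real.
apply/matrixP => a b; rewrite adjmxE !mxE rmorphN /= opprK.
have [ai|nai] := eqVneq a i.
  rewrite ai; have [bi|nbi] := eqVneq b i => //.
  have [bj|nbj] := eqVneq b j; first by rewrite rmorphN /= conjCK.
  by rewrite /= conjC0.
have [aj|naj] := eqVneq a j.
  rewrite aj; have [bi|nbi] := eqVneq b i => //.
  have [bj|nbj] := eqVneq b j => //.
  by rewrite /= conjC0.
have [ab|nab] := eqVneq a b.
  by rewrite -ab (negbTE nai) (negbTE naj) /= conjC1.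
by case: ifP; rewrite ?conjC0 //; case: ifP; rewrite ?conjC0.
Qed.

Lemma eq_colmx (A B : 'M[R[i]]_n) : (forall x, A *m x = B *m x) -> A = B.
Proof. by move=> h; apply/matrixP => a b; have := h (delta_mx b 0); rewrite -!colE => /colP/(_ a); rewrite !mxE. Qed.

Lemma givensK i j c z x : i != j -> c ^+ 2 + csq z = 1 ->
  givens i j c (- z) *m (givens i j c z *m x) = x.
Proof.
move=> ij cz; have ji : (j == i) = false by rewrite eq_sym (negbTE ij).
have h : c%:C * c%:C + Num.conj z * z = 1 :> R[i].
  by rewrite csqE -rmorphM -rmorphD -expr2 /= cz.
apply/colP => a; rewrite !givensE // ji !eqxx rmorphN /= opprK.
have [->|nai] := eqVneq a i; first by transitivity ((c%:C * c%:C + Num.conj z * z) * x i 0); [ring|rewrite h mul1r].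
by have [->|//] := eqVneq a j; transitivity ((c%:C * c%:C + Num.conj z * z) * x j 0); [ring|rewrite h mul1r].
Qed.

(** For the 0-1 diagonal of [P] and [i], [j] both in [J], this says that rotations inside the macro
    space commute with [P]. *)
Lemma givens_comm i j c z (k : 'I_n -> R) : k i = k j ->
  givens i j c z *m rdiag k = rdiag k *m givens i j c z.
Proof.
move=> kij; apply/matrixP => a b; rewrite mul_diag_mx mul_mx_diag !mxE mulrC.
have [->|nai] := eqVneq a i.
  have [->//|nbi] := eqVneq b i; have [->|_] := eqVneq b j; first by rewrite kij.
  by rewrite !mulr0.
have [->|naj] := eqVneq a j.
  have [->|nbi] := eqVneq b i; first by rewrite kij.
  by have [->//|_] := eqVneq b j; rewrite !mulr0.
by have [->//|] := eqVneq a b; rewrite !mulr0.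
Qed.

Definition rot V i j c z := adjmx V *m givens i j c z *m V.

Lemma rotK V i j c z x : V *m adjmx V = 1%:M -> adjmx V *m V = 1%:M ->
  i != j -> c ^+ 2 + csq z = 1 ->
  rot V i j c (- z) *m (rot V i j c z *m x) = x.
Proof.
move=> VV VV' ij cz; rewrite /rot -!mulmxA [V *m _]mulmxA VV mul1mx.
by rewrite givensK // mulmxA VV' mul1mx.
Qed.

Lemma rot_unitary V i j c z : V *m adjmx V = 1%:M -> adjmx V *m V = 1%:M ->
  i != j -> c ^+ 2 + csq z = 1 -> Defs.unitarymx (rot V i j c z).
Proof.
move=> VV VV' ij cz; rewrite /Defs.unitarymx.
have -> : adjmx (rot V i j c z) = rot V i j c (- z).
  by rewrite /rot !adjmxM adjmxK adjmx_givens // mulmxA.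
by apply: eq_colmx => x; rewrite -mulmxA rotK // mul1mx.
Qed.

Lemma rot_comm V i j c z k : V *m adjmx V = 1%:M -> k i = k j ->
  let P := adjmx V *m rdiag k *m V in rot V i j c z *m P = P *m rot V i j c z.
Proof.
move=> VV kij /=; rewrite /rot -!mulmxA; congr (_ *m _).
by rewrite ![V *m (adjmx V *m _)]mulmxA VV !mul1mx !mulmxA givens_comm.
Qed.

Definition cross V (i j : 'I_n) x : R[i] := Num.conj ((V *m x) i 0) * (V *m x) j 0.

Lemma csq_cross V i j x : csq (cross V i j x) = weight V i x * weight V j x.
Proof.
rewrite /cross /weight; case: (_ i 0) => a b; case: (_ j 0) => a' b'.
by rewrite conjE /csq /=; ring.
Qed.

(** Expand [|c y_i + z y_j|^2]: an amount [D] of weight moves from [j] to [i]. *)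
Lemma weight_rot V i j c z x a : V *m adjmx V = 1%:M -> i != j -> 
  c ^+ 2 + csq z = 1 ->
  let D := csq z * (weight V j x - weight V i x) +
    2 * c * (complex.Re z * complex.Re (cross V i j x) - complex.Im z * complex.Im (cross V i j x)) in
  weight V a (rot V i j c z *m x) =
  weight V a x + (if a == i then D else if a == j then - D else 0).
Proof.
move=> VV ij cz D; rewrite /D /weight /rot -!mulmxA mulmxA VV mul1mx givensE // /cross.
move: (V *m x) => y.
(* The identities hold modulo [c ^+ 2 + csq z = 1]; [g] is the multiplier of this relation that
   leaves a polynomial identity. *)
have red (e f g : R) : e - f = (c ^+ 2 + csq z - 1) * g -> e = f.
  by rewrite cz subrr mul0r => /subr0_eq.
have [->|nai] := eqVneq a i.
  apply: (red _ _ (csq (y i 0))); case: z (y i 0) (y j 0) {cz red D} => [z1 z2] [a1 a2] [b1 b2].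
  by rewrite conjE /csq /=; ring.
have [->|naj] := eqVneq a j; last by rewrite addr0.
apply: (red _ _ (csq (y j 0))); case: z (y i 0) (y j 0) {cz red D} => [z1 z2] [a1 a2] [b1 b2].
by rewrite conjE /csq /=; ring.
Qed.

Lemma wsum_rot V (l : 'I_n -> R) i j c z x : V *m adjmx V = 1%:M -> i != j ->
  c ^+ 2 + csq z = 1 ->
  \sum_a l a * weight V a (rot V i j c z *m x) =
  \sum_a l a * weight V a x + (l i - l j) *
    (csq z * (weight V j x - weight V i x) +
     2 * c * (complex.Re z * complex.Re (cross V i j x) - complex.Im z * complex.Im (cross V i j x))).
Proof.
move=> VV ij cz; have ji : (j == i) = false by rewrite eq_sym (negbTE ij).
under eq_bigr do rewrite (weight_rot _ _ VV ij cz) mulrDr.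
rewrite big_split /=; congr (_ + _).
rewrite (bigD1 i) //= (bigD1 j) ?ji //= ?eqxx ?ji big1 ?addr0; last first.
  by move=> a /andP[/negbTE -> /negbTE ->]; rewrite mulr0.
ring.
Qed.

End Givens.

(** * Expectations of bounded functions and exchangeable pairs *)

Section BoundedExpectation.
Context d (T : measurableType d) (R : realType) (u : probability T R) (S : set T).
Hypotheses (mS : measurable S) (uS : u S = 1%E).
Implicit Types (f g : T -> R).

(** Bounded on [S] only, since quadratic forms are bounded on the sphere but not on the whole space;
    this suffices for integrability over [S]. *)
Definition bmeas f := measurable_fun setT f /\ exists M, forall x, S x -> `|f x| <= M.

Definition mean f : R := \int[u]_(x in S) f x.

Lemma bmeas_cst (r : R) : bmeas (fun=> r).
Proof. by split; [exact: measurable_cst|exists `|r|]. Qed.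

Lemma bmeasD f g : bmeas f -> bmeas g -> bmeas (fun x => f x + g x).
Proof.
move=> [mf [M hM]] [mg [N hN]]; split; first exact: measurable_funD.
by exists (M + N) => x Sx; rewrite (le_trans (ler_normD _ _)) // lerD ?hM ?hN.
Qed.

Lemma bmeasM f g : bmeas f -> bmeas g -> bmeas (fun x => f x * g x).
Proof.
move=> [mf [M hM]] [mg [N hN]]; split; first exact: measurable_funM.
by exists (M * N) => x Sx; rewrite normrM ler_pM ?hM ?hN.
Qed.

Lemma bmeasZ r f : bmeas f -> bmeas (fun x => r * f x).
Proof. exact/bmeasM/bmeas_cst. Qed.

Lemma bmeasB f g : bmeas f -> bmeas g -> bmeas (fun x => f x - g x).
Proof.
move=> bf bg; have /(bmeasD bf) := bmeasZ (-1) bg.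
by congr bmeas; apply/funext => x; rewrite mulN1r.
Qed.

Lemma bmeasX f k : bmeas f -> bmeas (fun x => f x ^+ k).
Proof.
move=> bf; elim: k => [|k IH]; first exact: bmeas_cst.
by have := bmeasM bf IH; congr bmeas; apply/funext => x; rewrite exprS.
Qed.

Lemma bmeas_sum I (s : seq I) (Q : pred I) (F : I -> T -> R) :
  (forall i, Q i -> bmeas (F i)) -> bmeas (fun x => \sum_(i <- s | Q i) F i x).
Proof.
move=> bF; elim: s => [|i s IH].
  by have := bmeas_cst 0; congr bmeas; apply/funext => x; rewrite big_nil.
case: (boolP (Q i)) => Qi.
  by have := bmeasD (bF _ Qi) IH; congr bmeas; apply/funext => x; rewrite big_cons Qi.
by move: IH; congr bmeas; apply/funext => x; rewrite big_cons (negbTE Qi).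
Qed.

Lemma bmeas_integrable f : bmeas f -> u.-integrable S (EFin \o f).
Proof.
move=> [mf [M hM]]; apply: measurable_bounded_integrable => //.
- by apply: (le_lt_trans (probability_le1 u mS)); rewrite ltry.
- exact: measurable_funS mf.
- exists M; split; first exact: num_real.
  by move=> y My x Sx; apply: le_trans (hM _ Sx) (ltW My).
Qed.

Lemma meanD f g : bmeas f -> bmeas g -> mean (fun x => f x + g x) = mean f + mean g.
Proof. by move=> *; apply: RintegralD => //; exact: bmeas_integrable. Qed.

Lemma meanB f g : bmeas f -> bmeas g -> mean (fun x => f x - g x) = mean f - mean g.
Proof. by move=> *; apply: RintegralB => //; exact: bmeas_integrable. Qed.

Lemma meanZ r f : bmeas f -> mean (fun x => r * f x) = r * mean f.
Proof. by move=> *; apply: RintegralZl => //; exact: bmeas_integrable. Qed.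

Lemma mean_cst r : mean (fun=> r) = r.
Proof.
rewrite /mean Rintegral_cst // -[RHS]mulr1; congr (_ * _).
by rewrite -[LHS]/(fine (u S)) uS.
Qed.

Lemma eq_mean f g : (forall x, S x -> f x = g x) -> mean f = mean g.
Proof. by move=> fg; apply: eq_Rintegral => x /[!inE] /fg. Qed.

Lemma le_mean f g : bmeas f -> bmeas g -> (forall x, S x -> f x <= g x) -> mean f <= mean g.
Proof. by move=> *; apply: le_Rintegral => //; exact: bmeas_integrable. Qed.

Lemma mean_sum I (s : seq I) (Q : pred I) (F : I -> T -> R) :
  (forall i, Q i -> bmeas (F i)) ->
  mean (fun x => \sum_(i <- s | Q i) F i x) = \sum_(i <- s | Q i) mean (F i).
Proof.
move=> bF; elim: s => [|i s IH].
  by rewrite big_nil -[RHS](mean_cst 0); apply: eq_mean => x _; rewrite big_nil.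
rewrite big_cons; case: ifP => Qi.
  rewrite -IH -meanD; [|exact: bF|exact: bmeas_sum].
  by apply: eq_mean => x _; rewrite big_cons Qi.
by rewrite -IH; apply: eq_mean => x _; rewrite big_cons Qi.
Qed.

Lemma EFin_mean f : bmeas f -> (mean f)%:E = (\int[u]_(x in S) (f x)%:E)%E.
Proof. by move=> bf; rewrite /mean /Rintegral fineK // integrable_fin_num //; exact: bmeas_integrable. Qed.

Section Invariance.
Variable tau : T -> T.
Hypotheses (mtau : measurable_fun setT tau) (tauS : tau @^-1` S = S).
Hypothesis inv : forall A, measurable A -> u (tau @^-1` A) = u A.

Lemma bmeas_comp f : bmeas f -> bmeas (f \o tau).
Proof.
move=> [mf [M hM]]; split; first exact: measurableT_comp.
by exists M => x Sx; apply: hM; rewrite -[S _]/((tau @^-1` S) x) tauS.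
Qed.

Lemma mean_comp f : bmeas f -> mean (f \o tau) = mean f.
Proof.
move=> bf; apply: EFin_inj; rewrite !EFin_mean //; last exact: bmeas_comp.
have := @integral_pushforward _ _ _ _ _ _ mtau u S (EFin \o f).
rewrite tauS => <- //.
- by apply: eq_measure_integral => A mA _; exact: inv.
- by apply/measurable_EFinP; case: bf.
- exact/bmeas_integrable/bmeas_comp.
Qed.

End Invariance.

End BoundedExpectation.

(** * Moment inequality for an exchangeable pair *)

Lemma ler_powM2n (R : realType) (a b : R) (i j : nat) : 
  `|a| ^+ i * `|b| ^+ j <= `|a| ^+ (i + j) + `|b| ^+ (i + j).
Proof.
rewrite !exprD; have [ab|/ltW ba] := leP `|a| `|b|.
  rewrite -[leLHS]add0r lerD ?mulr_ge0 ?exprn_ge0 //.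
  by rewrite ler_wpM2r ?exprn_ge0 // lerXn2r ?nnegrE.
rewrite -[leLHS]addr0 lerD ?mulr_ge0 ?exprn_ge0 //.
by rewrite ler_wpM2l ?exprn_ge0 // lerXn2r ?nnegrE.
Qed.

(** Each of the [2m + 1] terms of the quotient by [a - b] has degree [2m], so it is at most
    [a^(2m) + b^(2m)]. At [m = 0] this loses a factor 2, which is why the variance is later taken
    from the exact [exchangeable_pair]. *)
Lemma mul_sub_odd_exp (R : realType) (a b : R) (m : nat) :
  (a - b) * (a ^+ m.*2.+1 - b ^+ m.*2.+1) <=
  m.*2.+1%:R * ((a - b) ^+ 2 * (a ^+ m.*2 + b ^+ m.*2)).
Proof.
rewrite subrXX [leLHS]mulrA -[(a - b) * (a - b)]expr2 [leRHS]mulrCA ler_wpM2l ?sqr_ge0 //.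
rewrite -[X in X%:R]card_ord mulr_natl -sumr_const.
apply: ler_sum => i _; rewrite (le_trans (ler_norm _)) // normrM !normrX.
have im : (m.*2.+1 - i.+1 + i = m.*2)%N by rewrite subSS subnK // -ltnS.
have even (x : R) : x ^+ m.*2 = `|x| ^+ m.*2.
  by rewrite -mul2n [LHS]exprM [RHS]exprM real_normK ?num_real.
by rewrite (le_trans (ler_powM2n _ _ _ _)) // im (even a) (even b).
Qed.

Section ExchangeablePair.
Context d (T : measurableType d) (R : realType) (u : probability T R) (S : set T).
Hypotheses (mS : measurable S) (uS : u S = 1%E).
Variables (K : finType) (Q : pred K) (tau : K -> T -> T) (iota : K -> K).
Hypotheses (mtau : forall k, Q k -> measurable_fun setT (tau k))
  (tauS : forall k, Q k -> tau k @^-1` S = S)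
  (inv : forall k, Q k -> forall A, measurable A -> u (tau k @^-1` A) = u A)
  (iotaK : involutive iota) (iotaQ : forall k, Q (iota k) = Q k)
  (tauK : forall k x, Q k -> tau (iota k) (tau k x) = x).
Local Notation bmeas := (bmeas S).
Local Notation mean := (mean u S).
Implicit Types f g : T -> R.

Lemma bmeas_tau f k : Q k -> bmeas f -> bmeas (fun x => f (tau k x)).
Proof. by move=> Qk; apply: (bmeas_comp (mtau Qk) (tauS Qk)). Qed.

Lemma mean_tau f k : Q k -> bmeas f -> mean (fun x => f (tau k x)) = mean f.
Proof. by move=> Qk; apply: (mean_comp mS (mtau Qk) (tauS Qk) (inv Qk)). Qed.

Lemma sum_iota (F : K -> R) : \sum_(k | Q k) F (iota k) = \sum_(k | Q k) F k.
Proof.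
rewrite [RHS](reindex_inj (can_inj iotaK)) /=.
by apply: eq_bigl => k; rewrite iotaQ.
Qed.

Hint Resolve bmeasD bmeasB bmeasM bmeasX bmeas_tau bmeas_cst : core.

(** Expand in [g]. As [tau k] preserves the measure and [tau (iota k)] inverts it, the part with
    [g (tau k x)] has the mean of [(f x - f (tau (iota k) x)) * g x]. After reindexing by [iota],
    both parts give [L] times the mean of [f * g]. *)
Lemma exchangeable_pair f g (L : R) : bmeas f -> bmeas g ->
  (forall x, S x -> \sum_(k | Q k) (f x - f (tau k x)) = L * f x) ->
  mean (fun x => \sum_(k | Q k) (f x - f (tau k x)) * (g x - g (tau k x))) =
  2 * L * mean (fun x => f x * g x).
Proof.
move=> bf bg Lf; rewrite mean_sum //; last by auto.
transitivity (\sum_(k | Q k) (mean (fun x => (f x - f (tau k x)) * g x) +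
                              mean (fun x => (f x - f (tau (iota k) x)) * g x))).
  apply: eq_bigr => k Qk; have Qik : Q (iota k) by rewrite iotaQ.
  have -> : mean (fun x => (f x - f (tau (iota k) x)) * g x) =
      mean (fun x => (f (tau k x) - f x) * g (tau k x)).
    by rewrite -(mean_tau Qk); [apply: eq_mean => x _; rewrite tauK|auto].
  by rewrite -meanD //; [apply: eq_mean => x _; ring|auto|auto].
rewrite big_split /= (sum_iota (fun k => mean (fun x => (f x - f (tau k x)) * g x))).
rewrite -mean_sum //; last by auto.
have -> : mean (fun x => \sum_(k | Q k) (f x - f (tau k x)) * g x) =
    mean (fun x => L * (f x * g x)).
  by apply: eq_mean => x Sx; rewrite -mulr_suml Lf // mulrA.
by rewrite meanZ //; [ring|auto].
Qed.

(** The pair identity with [g = f^(2m+1)], whose left side is then estimated by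
    [mul_sub_odd_exp]. *)
Lemma moment_step f (L v : R) m : bmeas f -> 
  (forall x, S x -> \sum_(k | Q k) (f x - f (tau k x)) = L * f x) ->
  (forall x, S x -> \sum_(k | Q k) (f x - f (tau k x)) ^+ 2 <= v) ->
  L * mean (fun x => f x ^+ m.+1.*2) <= m.*2.+1%:R * (v * mean (fun x => f x ^+ m.*2)).
Proof.
move=> bf Lf vf.
have := exchangeable_pair bf (bmeasX m.*2.+1 bf) Lf.
have -> : mean (fun x => f x * f x ^+ m.*2.+1) = mean (fun x => f x ^+ m.+1.*2).
  by apply: eq_mean => x _; rewrite -exprS doubleS.
move=> E; rewrite -(ler_pM2l (ltr0n R 2))  [leLHS]mulrA -E.
have b2 k : Q k -> bmeas (fun x => (f x - f (tau k x)) ^+ 2 * f x ^+ m.*2) by auto 6.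
apply: (@le_trans _ _ (mean (fun x => \sum_(k | Q k)
    m.*2.+1%:R * ((f x - f (tau k x)) ^+ 2 * (f x ^+ m.*2 + f (tau k x) ^+ m.*2))))).
  apply: le_mean => //; [by apply: bmeas_sum => k Qk; auto| |].
    by apply: bmeas_sum => k Qk; apply: bmeasZ; auto 8.
  by move=> x Sx; apply: ler_sum => k Qk; exact: mul_sub_odd_exp.
rewrite mean_sum //; last by move=> k Qk; apply: bmeasZ; auto 8.
(* By exchangeability the half with [f (tau k x)] has the same total as the half with [f x]; the
   resulting 2 cancels that of the pair identity. *)
have -> : \sum_(k | Q k) mean (fun x => m.*2.+1%:R *
     ((f x - f (tau k x)) ^+ 2 * (f x ^+ m.*2 + f (tau k x) ^+ m.*2))) =
   m.*2.+1%:R * (2 * mean (fun x => \sum_(k | Q k) (f x - f (tau k x)) ^+ 2 * f x ^+ m.*2)).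
  rewrite mean_sum // [2 * _]mulr_natl mulr2n -[X in _ * (_ + X)](sum_iota (fun k => mean (fun x => (f x - f (tau k x)) ^+ 2 * f x ^+ m.*2))).
  rewrite -big_split mulr_sumr /=; apply: eq_bigr => k Qk.
  have Qik : Q (iota k) by rewrite iotaQ.
  rewrite meanZ //; last by auto 8.
  have -> : mean (fun x => (f x - f (tau (iota k) x)) ^+ 2 * f x ^+ m.*2) =
      mean (fun x => (f x - f (tau k x)) ^+ 2 * f (tau k x) ^+ m.*2).
    by rewrite -(mean_tau Qk); [apply: eq_mean => x _; rewrite tauK // -sqrrN opprB|auto 7].
  by rewrite -meanD //; [congr (_ * _); apply: eq_mean => x _; ring|auto|auto 7].
rewrite mulrCA ler_wpM2l // ler_wpM2l // -meanZ //; last by auto.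
apply: le_mean => //; [by apply: bmeas_sum|by apply: bmeasZ; auto|].
move=> x Sx; rewrite -mulr_suml ler_wpM2r ?vf //.
by rewrite -mul2n exprM exprn_ge0 ?sqr_ge0.
Qed.

End ExchangeablePair.

(** * From moments to tails; Markov's inequality *)

Section Tails.
Context d (T : measurableType d) (R : realType) (u : probability T R) (S : set T).
Hypotheses (mS : measurable S) (uS : u S = 1%E).
Local Notation bmeas := (bmeas S).
Local Notation mean := (mean u S).
Implicit Types f : T -> R.

Lemma bmeas_indic A : measurable A -> bmeas (\1_A : T -> R).
Proof.
move=> mA; split; first exact: measurable_indic.
by exists 1 => x _; rewrite indicE; case: (_ \in _); rewrite ?normr1 ?normr0.
Qed.

Lemma mean_indic A : measurable A -> A `<=` S -> (mean \1_A)%:E = u A.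
Proof.
move=> mA AS; rewrite EFin_mean //; last exact: bmeas_indic.
by rewrite integral_indic // setIidl.
Qed.

(** Iterate, using [2m + 1 <= 2 (m + 1)] to replace the double factorial by [2^m m!]. *)
Lemma moment_bound f (c : R) : 0 <= c -> 
  (forall m, mean (fun x => f x ^+ m.+1.*2) <= m.*2.+1%:R * (c * mean (fun x => f x ^+ m.*2))) ->
  forall m, mean (fun x => f x ^+ m.*2) <= m`!%:R * (2 * c) ^+ m.
Proof.
move=> c0 step; elim=> [|m IH].
  by rewrite fact0 mulr1 (_ : (fun _ => _) = fun=> 1) ?mean_cst //; apply/funext => x.
have p0 : 0 <= m`!%:R * (2 * c) ^+ m by rewrite mulr_ge0 // exprn_ge0 // mulr_ge0.
apply: (le_trans (step m)); apply: (@le_trans _ _ (m.*2.+1%:R * (c * (m`!%:R * (2 * c) ^+ m)))).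
  by rewrite ler_wpM2l // ler_wpM2l.
rewrite factS natrM exprS.
have -> : m.+1%:R * m`!%:R * (2 * c * (2 * c) ^+ m) = 
   (m.+1.*2)%:R * (c * (m`!%:R * (2 * c) ^+ m)) by rewrite -muln2 natrM; ring.
rewrite ler_wpM2r //; first exact: mulr_ge0.
by rewrite ler_nat doubleS.
Qed.

(** Markov's inequality for [exp (f^2 / (4c))]: with [a = 1 / (4c)], the moments [m! (2c)^m] give a
    geometric series of ratio 1/2, whose sum is the factor 2. *)
Lemma subgaussian_tail f (c eta : R) : bmeas f -> 0 < c -> 0 <= eta ->
  (forall m, mean (fun x => f x ^+ m.+1.*2) <= m.*2.+1%:R * (c * mean (fun x => f x ^+ m.*2))) ->
  (u (S `&` [set x | (eta <= `|f x|)%R]) <= (2 * expR (- (eta ^+ 2 / (4 * c))))%:E)%E.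
Proof.
move=> bf c0 e0 /(moment_bound (ltW c0)) mom; set A := S `&` _.
have mA : measurable A.
  apply: measurableI => //; rewrite -[X in measurable X]setTI.
  rewrite (_ : [set x | _] = (fun x => `|f x|) @^-1` `[eta, +oo[).
    by apply: (measurableT_comp (@normr_measurable R setT) (proj1 bf)).
  by apply/seteqP; split => x /=; rewrite in_itv /= andbT.
rewrite -mean_indic //; last by move=> x [].
set p := mean _; set y := eta ^+ 2 / (4 * c).
have p0 : 0 <= p by apply: Rintegral_ge0 => x _; rewrite indicE.
have even (m : nat) (x : R) : x ^+ m.*2 = (x ^+ 2) ^+ m by rewrite -mul2n exprM.
(* Only partial sums are integrated; the limit in [N] is taken afterwards, on numbers. *)
have part N : p * series (exp_coeff y) N <= 2.
  pose a : R := (4 * c)^-1.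
  have a0 : 0 < a by rewrite invr_gt0 mulr_gt0.
  apply: (@le_trans _ _ (mean (fun x => \sum_(0 <= m < N) a ^+ m / m`!%:R * f x ^+ m.*2))).
    rewrite mulrC -meanZ //; last exact: bmeas_indic.
    apply: le_mean => //; [exact/bmeasZ/bmeas_indic| |].
      by apply: bmeas_sum => m _; apply/bmeasZ/bmeasX.
    move=> x Sx; rewrite indicE; case: (boolP (x \in A)) => [|_].
      rewrite inE => -[_ /= fx]; rewrite mulr1 /series /=.
      apply: ler_sum => m _; rewrite /exp_coeff /= even /y.
      rewrite [X in X ^+ m]mulrC exprMn -!mulrA [X in _ <= _ * X]mulrC.
      rewrite ler_wpM2l ?exprn_ge0 ?(ltW a0) // ler_wpM2r ?invr_ge0 //.
      rewrite lerXn2r ?nnegrE ?sqr_ge0 // -[leRHS]real_normK ?num_real //.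
      by rewrite lerXn2r ?nnegrE.
    rewrite mulr0; apply: sumr_ge0 => m _.
    apply: mulr_ge0; last by rewrite even exprn_ge0 // sqr_ge0.
    by rewrite divr_ge0 // exprn_ge0 // ltW.
  rewrite mean_sum //; last by move=> m _; apply/bmeasZ/bmeasX.
  apply: (@le_trans _ _ (\sum_(0 <= m < N) 2^-1 ^+ m)).
    apply: ler_sum => m _; rewrite meanZ //; last exact: bmeasX.
    apply: (le_trans (ler_wpM2l _ (mom m))); first by rewrite divr_ge0 // exprn_ge0 ?(ltW a0).
    have -> : a ^+ m / m`!%:R * (m`!%:R * (2 * c) ^+ m) = (a * (2 * c)) ^+ m.
      rewrite [RHS]exprMn mulrA divfK // pnatr_eq0 -lt0n fact_gt0 //.
    by rewrite (_ : a * _ = 2^-1) // /a; field; rewrite gt_eqF.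
  have : series (geometric (1 : R) 2^-1) N <= 2.
    rewrite geometric_seriesE /=; last by rewrite lt_eqF // invf_lt1 // ltr1n.
    have : 0 <= (2^-1 : R) ^+ N by rewrite exprn_ge0.
    have -> : 1 - 2^-1 = 2^-1 :> R by field.
    by rewrite invrK; move: (_ ^+ N) => q; lra.
  by apply: le_trans; rewrite /series /=; apply: ler_sum => m _; rewrite /geometric /= mul1r.
rewrite lee_fin expRN ler_pdivlMr ?expR_gt0 //.
move: p0; rewrite le_eqVlt => /predU1P[<-|p0]; first by rewrite mul0r.
rewrite mulrC -ler_pdivlMr //; apply: limr_le; first exact: is_cvg_series_exp_coeff.
by apply: nearW => N; rewrite ler_pdivlMr // mulrC.
Qed.

Lemma prob_of_bad (G : set T) (e : R) : measurable G ->
  (u (S `&` ~` G) <= e%:E)%E -> ((1 - e)%:E <= u G)%E.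
Proof.
move=> mG h; rewrite EFinB leeBlDr //.
rewrite -uS; apply: (@le_trans _ _ (u (G `|` (S `&` ~` G)))).
  apply: le_measure; rewrite ?inE //.
    by apply: measurableU => //; apply: measurableI => //; exact: measurableC.
  by move=> x Sx; have [Gx|nGx] := pselect (G x); [left|right].
apply: le_trans (leeD2l _ h); apply: measureU2 => //.
by apply: measurableI => //; exact: measurableC.
Qed.

Lemma markov_prob (f : T -> \bar R) (eps a : R) : measurable_fun setT f ->
  (forall x, 0 <= f x)%E -> 0 < eps -> 0 <= a ->
  (\int[u]_(x in S) f x <= (eps * a)%:E)%E ->
  ((1 - eps)%:E <= u [set x | (f x <= a%:E)%E])%E.
Proof.
move=> mf f0 e0 a0 hf; apply: prob_of_bad.
  by rewrite -[X in measurable X]setTI; exact: emeasurable_fun_infty_c.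
set A := S `&` _.
have AE : A = S `&` [set x | (a%:E < f x)%E].
  by congr (_ `&` _); apply/seteqP; split => x /=; rewrite ltNge => /negP.
have mA : measurable A by rewrite AE; apply: emeasurable_fun_o_infty => //; exact: measurable_funS mf.
(* The level [a = 0] occurs when [opnorm B = 0] and forbids division; then [f] has integral 0 and
   vanishes almost everywhere on [S]. *)
move: a0; rewrite le_eqVlt => /predU1P[a0|a0].
  suff -> : u A = 0%E by rewrite lee_fin ltW.
  have : ae_eq u S f (cst 0%E).
    apply/ae_eq_integral_abs => //; first exact: measurable_funS mf.
    apply/eqP; rewrite eq_le integral_ge0 // andbT.
    under eq_integral do rewrite gee0_abs //.
    by move: hf; rewrite -a0 mulr0.
  move=> [N [mN uN0 sub]]; apply: (subset_measure0 (B := N)) => //.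
  move=> x; rewrite AE => -[Sx /=]; rewrite -a0 => fx.
  by apply: sub => /= /(_ Sx) fx0; move: fx; rewrite fx0 ltxx.
rewrite -(lee_pmul2l (x := a%:E)) //.
apply: (@le_trans _ _ (\int[u]_(x in A) f x)%E); last first.
  rewrite -EFinM mulrC; apply: le_trans hf; apply: ge0_subset_integral => //.
    exact: measurable_funS mf.
  by rewrite AE; move=> x [].
rewrite -integral_cst //; apply: ge0_le_integral => //.
- by move=> x _; rewrite lee_fin ltW.
- exact: measurable_funS mf.
- by move=> x; rewrite AE => -[_ /ltW].
Qed.

End Tails.

(** * Measurability on the sphere *)

Section ComplexMeasurable.
Context d (T : measurableType d) (R : realType).
Implicit Types f g : T -> R[i].

Definition cmeas f := measurable_fun setT (fun x => complex.Re (f x)) /\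
  measurable_fun setT (fun x => complex.Im (f x)).

Lemma cmeas_cst z : cmeas (fun=> z).
Proof. by split; exact: measurable_cst. Qed.

Lemma cmeasD f g : cmeas f -> cmeas g -> cmeas (fun x => f x + g x).
Proof.
move=> [f1 f2] [g1 g2]; split.
  rewrite (_ : (fun x => _) = (fun x => complex.Re (f x) + complex.Re (g x))).
    exact: measurable_funD.
  by apply/funext => x; rewrite raddfD.
rewrite (_ : (fun x => _) = (fun x => complex.Im (f x) + complex.Im (g x))).
  exact: measurable_funD.
by apply/funext => x; rewrite raddfD.
Qed.

Lemma cmeasM f g : cmeas f -> cmeas g -> cmeas (fun x => f x * g x).
Proof.
move=> [f1 f2] [g1 g2]; split.
  rewrite (_ : (fun x => _) = (fun x => complex.Re (f x) * complex.Re (g x) - complex.Im (f x) * complex.Im (g x))).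
    by apply: measurable_funB; exact: measurable_funM.
  by apply/funext => x; case: (f x) (g x) => [? ?] [? ?].
rewrite (_ : (fun x => _) = (fun x => complex.Re (f x) * complex.Im (g x) + complex.Im (f x) * complex.Re (g x))).
  by apply: measurable_funD; exact: measurable_funM.
by apply/funext => x; case: (f x) (g x) => [? ?] [? ?].
Qed.

Lemma cmeasJ f : cmeas f -> cmeas (fun x => Num.conj (f x)).
Proof.
move=> [f1 f2]; split.
  by move: f1; congr measurable_fun; apply/funext => x; rewrite conjE; case: (f x).
rewrite (_ : (fun x => _) = (fun x => - complex.Im (f x))); first exact: measurableT_comp.
by apply/funext => x; rewrite conjE; case: (f x).
Qed.

Lemma cmeas_sum (I : Type) (s : seq I) (F : I -> T -> R[i]) :
  (forall i, cmeas (F i)) -> cmeas (fun x => \sum_(i <- s) F i x).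
Proof.
move=> mF; elim: s => [|i s IH].
  by rewrite (_ : (fun x => _) = (fun=> 0)); [exact: cmeas_cst|apply/funext => x; rewrite big_nil].
rewrite (_ : (fun x => _) = (fun x => F i x + \sum_(j <- s) F j x)); first exact: cmeasD.
by apply/funext => x; rewrite big_cons.
Qed.

Lemma cmeas_csq f : cmeas f -> measurable_fun setT (fun x => csq (f x)).
Proof. by move=> [f1 f2]; apply: measurable_funD; exact: measurable_funX. Qed.

Lemma cmeas_mulmx (m n p : nat) (A : T -> 'M[R[i]]_(m, n)) (B : T -> 'M[R[i]]_(n, p)) :
  (forall i j, cmeas (fun x => A x i j)) -> (forall i j, cmeas (fun x => B x i j)) ->
  forall i j, cmeas (fun x => (A x *m B x) i j).
Proof.
move=> mA mB i j; rewrite (_ : (fun x => _) = (fun x => \sum_k A x i k * B x k j)).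
  by apply: cmeas_sum => k; exact: cmeasM.
by apply/funext => x; rewrite mxE.
Qed.

Lemma cmeas_dotc n (A B : T -> 'cV[R[i]]_n) :
  (forall i, cmeas (fun x => A x i 0)) -> (forall i, cmeas (fun x => B x i 0)) ->
  cmeas (fun x => dotc (A x) (B x)).
Proof.
move=> mA mB; apply: (cmeas_mulmx (A := fun x => adjmx (A x)) (B := B)) => i j.
  rewrite (_ : (fun x => _) = (fun x => Num.conj (A x j 0))); first exact: cmeasJ.
  by apply/funext => x; rewrite adjmxE !ord1.
by rewrite !ord1.
Qed.

End ComplexMeasurable.

Section Sphere.
Variables (R : realType) (n : nat).

Lemma cmeas_coord (j : 'I_n) : cmeas (fun x : CV R n => (x : 'cV[R[i]]_n) j 0).
Proof.
by split => _ A mA; rewrite setTI; apply: sub_sigma_algebra;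
  [exists j, true, A|exists j, false, A].
Qed.

Lemma measurable_cvec d (T : measurableType d) (F : T -> CV R n) :
  (forall j, cmeas (fun x => (F x : 'cV[R[i]]_n) j 0)) -> measurable_fun setT F.
Proof.
move=> mF; apply: (@measurability _ _ T (CV R n) setT F (@cvec_gen R n)) => //.
move=> _ [_ [j [b [A [mA ->]]]] <-]; rewrite setTI.
have [m1 m2] := mF j; case: b; first by have := m1 measurableT A mA; rewrite setTI.
by have := m2 measurableT A mA; rewrite setTI.
Qed.

Lemma cmeas_mulmx_coord (U : 'M[R[i]]_n) (j : 'I_n) :
  cmeas (fun x : CV R n => (U *m (x : 'cV[R[i]]_n)) j 0).
Proof.
apply: (cmeas_mulmx (A := fun=> U) (B := fun x : CV R n => (x : 'cV[R[i]]_n))).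
  by move=> i k; exact: cmeas_cst.
by move=> i k; rewrite (ord1 k); exact: cmeas_coord.
Qed.

Lemma measurable_mulmx (U : 'M[R[i]]_n) :
  measurable_fun setT (fun x : CV R n => (U *m (x : 'cV[R[i]]_n) : CV R n)).
Proof. by apply: measurable_cvec => j; exact: cmeas_mulmx_coord. Qed.

Lemma measurable_weight (V : 'M[R[i]]_n) j :
  measurable_fun setT (fun x : CV R n => weight V j x).
Proof. by apply: cmeas_csq; exact: cmeas_mulmx_coord. Qed.

Lemma csq_eq0 (z : R[i]) : (csq z == 0) = (z == 0).
Proof. by rewrite /csq paddr_eq0 ?sqr_ge0 // !sqrf_eq0 eq_complex. Qed.

(** Two equations between measurable real functions cut out the sphere: [|(P - 1) x|^2 = 0] and
    [|x|^2 = 1]. *)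
Lemma measurable_sphere (P : 'M[R[i]]_n) : measurable (sphere P : set (CV R n)).
Proof.
have -> : sphere P = (fun x : CV R n => \sum_j weight (P - 1%:M) j x) @^-1` [set 0] `&`
    (fun x : CV R n => \sum_j weight 1%:M j x) @^-1` [set 1].
  apply/seteqP; split => x /= [].
    move=> Px x1; split.
      by rewrite big1 // => j _; rewrite /weight mulmxBl Px mul1mx subrr mxE; apply/eqP; rewrite csq_eq0.
    by move: x1; rewrite (@weight_sum _ _ 1%:M) ?adjmx1 ?mul1mx // => -[].
  move=> h x1; split; last by rewrite (@weight_sum _ _ 1%:M) ?adjmx1 ?mul1mx // x1.
  apply/colP => j; apply/eqP; rewrite -subr_eq0 -csq_eq0; apply/eqP.
  have /eqP := h; rewrite psumr_eq0; last by move=> k _; exact: weight_ge0.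
  by move=> /allP/(_ j (mem_index_enum _))/eqP; rewrite /weight mulmxBl mul1mx !mxE.
apply: measurableI; rewrite -[X in measurable X]setTI.
  by apply: measurable_sum => // j; exact: measurable_weight.
by apply: measurable_sum => // j; exact: measurable_weight.
Qed.

Lemma sphere_preimage (P U : 'M[R[i]]_n) : adjmx U *m U = 1%:M -> U *m P = P *m U ->
  (fun x : 'cV[R[i]]_n => U *m x) @^-1` (sphere P) = sphere P.
Proof.
move=> UU UP; apply/seteqP; split => x /=; rewrite /sphere /= => -[Px x1].
  split; last by move: x1; rewrite dotc_adj mulmxA UU mul1mx.
  by have := congr1 (mulmx (adjmx U)) Px; rewrite !mulmxA -[adjmx U *m P *m U]mulmxA -UP !mulmxA UU !mul1mx.
by split; [rewrite mulmxA -UP -mulmxA Px //|rewrite dotc_adj mulmxA UU mul1mx].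
Qed.

End Sphere.

(** * Moments of diagonal quadratic forms on the sphere *)

Section DoubleSums.
Variables (R : realType) (I : finType) (J : {set I}).
Implicit Types a w : I -> R.

(** When [w] has total mass 1, this is [2 #|J|] times the centred sum of [a], the source of the
    linear drift. *)
Lemma sum_diff_mul a w :
  \sum_(i in J) \sum_(j in J) (a i - a j) * (w i - w j) =
  2 * (#|J|%:R * \sum_(i in J) a i * w i - (\sum_(i in J) a i) * (\sum_(i in J) w i)).
Proof.
have E i j : (a i - a j) * (w i - w j) = a i * w i + a j * w j - (a i * w j + a j * w i) by ring.
under eq_bigr => i _ do (under eq_bigr => j _ do rewrite E; rewrite sumrB !big_split /= sumr_const -mulr_sumr -mulr_suml).
rewrite sumrB !big_split /= sumr_const -mulr_sumr -mulr_suml.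
by rewrite sumrMnl -[_ *+ #|J|]mulr_natl; ring.
Qed.

(** When [w] has total mass 1, the right side is twice the variance of [a] under [w]. *)
Lemma sum_diff_sqr a w :
  \sum_(i in J) \sum_(j in J) (a i - a j) ^+ 2 * (w i * w j) =
  2 * ((\sum_(i in J) a i ^+ 2 * w i) * (\sum_(i in J) w i) - (\sum_(i in J) a i * w i) ^+ 2).
Proof.
have E i j : (a i - a j) ^+ 2 * (w i * w j) =
  a i ^+ 2 * w i * w j + w i * (a j ^+ 2 * w j) - 2 * (a i * w i) * (a j * w j) by ring.
under eq_bigr => i _ do (under eq_bigr => j _ do rewrite E; rewrite sumrB !big_split /= -!mulr_sumr).
by rewrite sumrB !big_split /= -!mulr_suml -mulr_sumr; ring.
Qed.

End DoubleSums.

Section RotationMoments.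
Variables (R : realType) (n : nat) (P V : 'M[R[i]]_n) (J : {set 'I_n}).
Variable u : probability (CV R n) R.
Hypotheses (VV : V *m adjmx V = 1%:M) (VV' : adjmx V *m V = 1%:M).
Hypothesis EP : P = adjmx V *m rdiag (fun j => (j \in J)%:R) *m V.
Hypothesis unif : uniform_on_sphere P u.
Hypothesis J0 : (0 < #|J|)%N.
Local Notation S := (sphere P : set (CV R n)).
Local Notation d := (#|J|%:R : R).
Local Notation w j x := (weight V j x).
Implicit Types (l : 'I_n -> R) (x : CV R n).

(** Makes each point of the sphere a probability vector carried by [J], the setting of the double
    sums above. *)
Lemma weight_sphere x : S x -> 
  (forall j, j \notin J -> w j x = 0) /\ \sum_(j in J) w j x = 1.
Proof.
move=> [Px x1]; have off j : j \notin J -> w j x = 0.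
  move=> jJ; rewrite /weight -Px EP -!mulmxA mulmxA VV mul1mx mul_diag_mx !mxE.
  by rewrite (negbTE jJ) mul0r /csq /= expr0n /= addr0.
split=> //; move: x1; rewrite (weight_sum x VV') => -[h].
by rewrite big_mkcond /= -[RHS]h; apply: eq_bigr => j _; case: ifPn => // /off ->.
Qed.

Lemma weight_le1 x j : S x -> w j x <= 1.
Proof.
move=> /weight_sphere[off sum1]; have [jJ|/off->//] := boolP (j \in J).
by rewrite -sum1 (bigD1 j) //= lerDl sumr_ge0 // => k _; exact: weight_ge0.
Qed.

Lemma bmeas_weight j : bmeas S (fun x => w j x).
Proof.
split; first exact: measurable_weight.
by exists 1 => x Sx; rewrite ger0_norm ?weight_ge0 // weight_le1.
Qed.

Definition wmean l := (\sum_(j in J) l j) / d.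
Definition wdev l x := \sum_j l j * w j x - wmean l.

Lemma bmeas_wsum l : bmeas S (fun x => \sum_j l j * w j x).
Proof. by apply: bmeas_sum => j _; apply/bmeasZ/bmeas_weight. Qed.

Lemma bmeas_wdev l : bmeas S (wdev l).
Proof. exact: bmeasB (bmeas_wsum l) (bmeas_cst _ _). Qed.

Lemma wsum_sphere l x : S x -> \sum_j l j * w j x = \sum_(j in J) l j * w j x.
Proof.
move=> /weight_sphere[off _]; rewrite [RHS]big_mkcond /=.
by apply: eq_bigr => j _; case: ifPn => // /off ->; rewrite mulr0.
Qed.

Let dgt0 : 0 < d. Proof. by rewrite ltr0n. Qed.

Section Angle.
(* [r] is the squared sine of the rotation angle. *)
Variable r : R.
Hypotheses (r0 : 0 < r) (r1 : r <= 1).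

Let s := Num.sqrt r.
Let c := Num.sqrt (1 - r).
(** The values [s, -s, i s, -i s] sum to 0, and their sum of [(Re (z a))^2] is [2 r |a|^2], whatever
    the phase of [a]. *)
Let z (b : bool * bool) : R[i] :=
  let t := if b.2 then s else - s in if b.1 then Complex t 0 else Complex 0 t.
Let K := ('I_n * 'I_n * (bool * bool))%type.
Let Q (k : K) := (k.1.1 \in J) && ((k.1.2 \in J) && (k.1.1 != k.1.2)).
Let iota (k : K) : K := (k.1, (k.2.1, ~~ k.2.2)).
Let tau (k : K) x : CV R n := rot V k.1.1 k.1.2 c (z k.2) *m (x : 'cV[R[i]]_n).

Let ss : s ^+ 2 = r. Proof. by rewrite sqr_sqrtr // ltW. Qed.
Let cc : c ^+ 2 = 1 - r. Proof. by rewrite sqr_sqrtr // subr_ge0. Qed.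
Let csqz b : csq (z b) = r.
Proof. by case: b => [[] []]; rewrite /z /csq /= ?sqrrN ?ss expr0n /= ?addr0 ?add0r. Qed.
Let cz b : c ^+ 2 + csq (z b) = 1. Proof. by rewrite cc csqz subrK. Qed.
Let zN b : z (b.1, ~~ b.2) = - z b.
Proof.
by case: b => [[] []]; rewrite /z /=; apply/eqP; rewrite eq_complex /= ?opprK ?oppr0 !eqxx.
Qed.

(** The pairs [i = j], excluded by [Q], are put back because [H] vanishes there; the result is a
    full double sum over [J]. *)
Let sumK (G : K -> R) (H : 'I_n -> 'I_n -> R) :
  (forall i, H i i = 0) ->
  (forall i j, i != j -> G (i, j, (true, true)) + G (i, j, (true, false)) +
     (G (i, j, (false, true)) + G (i, j, (false, false))) = H i j) ->
  \sum_(k | Q k) G k = \sum_(i in J) \sum_(j in J) H i j.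
Proof.
move=> H0 GH.
transitivity (\sum_(p : 'I_n * 'I_n | Q (p, (true, true))) \sum_(b : bool * bool) G (p, b)).
  by rewrite [RHS]pair_big_dep; apply: eq_big => -[[i j] b] //=; rewrite andbT.
transitivity (\sum_(i in J) \sum_(j | (j \in J) && (i != j)) \sum_(b : bool * bool) G (i, j, b)).
  by rewrite [RHS]pair_big_dep; apply: eq_big => -[i j].
apply: eq_bigr => i _; rewrite [RHS](bigID (fun j => i != j)) /= [X in _ = _ + X]big1 ?addr0.
  apply: eq_bigr => j /andP[_ ij]; rewrite -GH //.
  rewrite (eq_bigr (fun b : bool * bool => G (i, j, (b.1, b.2)))); last by case.
  by rewrite -(pair_bigA _ (fun a b => G (i, j, (a, b)))) big_bool !big_bool.
by move=> j /andP[_ /negPn/eqP <-].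
Qed.

Let tauE l k x : Q k -> wdev l (tau k x) = wdev l x + (l k.1.1 - l k.1.2) *
    (r * (w k.1.2 x - w k.1.1 x) + 2 * c * (complex.Re (z k.2) * complex.Re (cross V k.1.1 k.1.2 x) -
      complex.Im (z k.2) * complex.Im (cross V k.1.1 k.1.2 x))).
Proof.
move=> /and3P[_ _ ij]; rewrite /wdev /tau wsum_rot // ?cz // csqz; ring.
Qed.

(** Four phases give [4 r] per ordered pair, and [sum_diff_mul] supplies [2 d]. *)
Let drift l x : S x -> \sum_(k | Q k) (wdev l x - wdev l (tau k x)) = 8 * r * d * wdev l x.
Proof.
move=> Sx; transitivity (\sum_(k | Q k) (- ((l k.1.1 - l k.1.2) *
    (r * (w k.1.2 x - w k.1.1 x) + 2 * c * (complex.Re (z k.2) * complex.Re (cross V k.1.1 k.1.2 x) -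
      complex.Im (z k.2) * complex.Im (cross V k.1.1 k.1.2 x)))))).
  by apply: eq_bigr => k Qk; rewrite tauE //; ring.
rewrite (sumK (H := fun i j => 4 * r * ((l i - l j) * (w i x - w j x)))); last 2 first.
- by move=> i; rewrite subrr mul0r mulr0.
- by move=> i j ij /=; ring.
under eq_bigr do rewrite -mulr_sumr.
rewrite -mulr_sumr sum_diff_mul /wdev /wmean wsum_sphere // (proj2 (weight_sphere Sx)).
by field; rewrite gt_eqF.
Qed.

(** The part free of interference uses [|l i - l j| <= 2b]; the interference part is a variance, at
    most the second moment. Keeping that moment instead of [b ^+ 2] makes the variance bound
    sharp. *)
Let energy l (b : R) x : S x -> (forall j, j \in J -> `|l j| <= b) ->
  \sum_(k | Q k) (wdev l x - wdev l (tau k x)) ^+ 2 <=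
  32 * r ^+ 2 * b ^+ 2 * d + 16 * r * \sum_j l j ^+ 2 * w j x.
Proof.
move=> Sx lb.
rewrite (eq_bigr (fun k : K => ((l k.1.1 - l k.1.2) *
    (r * (w k.1.2 x - w k.1.1 x) + 2 * c * (complex.Re (z k.2) * complex.Re (cross V k.1.1 k.1.2 x) -
      complex.Im (z k.2) * complex.Im (cross V k.1.1 k.1.2 x)))) ^+ 2)); last first.
  by move=> k Qk; rewrite tauE //; ring.
rewrite (sumK (H := fun i j => 4 * r ^+ 2 * ((l i - l j) ^+ 2 * ((w i x - w j x) * (w i x - w j x))) +
    8 * (1 - r) * r * ((l i - l j) ^+ 2 * (w i x * w j x)))); last 2 first.
- by move=> i; rewrite subrr expr0n /= !mul0r !mulr0 addr0.
- move=> i j ij /=; rewrite -csq_cross /csq.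
  move: (complex.Re _) (complex.Im _) (w i x) (w j x) => re im p q.
  transitivity (4 * r ^+ 2 * ((l i - l j) ^+ 2 * ((p - q) * (p - q))) +
     8 * c ^+ 2 * s ^+ 2 * ((l i - l j) ^+ 2 * (re ^+ 2 + im ^+ 2))); first by ring.
  by rewrite cc ss.
have [off sum1] := weight_sphere Sx.
under eq_bigr do rewrite big_split /= -!mulr_sumr.
rewrite big_split /= -!mulr_sumr sum_diff_sqr sum1 mulr1 lerD //.
  rewrite (_ : 32 * _ * _ * _ = 4 * r ^+ 2 * (4 * b ^+ 2 * (2 * d))); last by ring.
  apply: ler_wpM2l; first by apply: mulr_ge0 => //; exact: sqr_ge0.
  apply: (@le_trans _ _ (4 * b ^+ 2 * \sum_(i in J) \sum_(j in J) (w i x - w j x) * (w i x - w j x))).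
    rewrite [leRHS]mulr_sumr; apply: ler_sum => i iJ; rewrite [leRHS]mulr_sumr; apply: ler_sum => j jJ.
    rewrite ler_wpM2r ?sqr_ge0 // -real_normK ?num_real //.
    have h : `|l i - l j| <= 2 * b.
      by rewrite (le_trans (ler_normB _ _)) // mulr2n mulrDl mul1r lerD // lb.
    by rewrite (_ : 4 * b ^+ 2 = (2 * b) ^+ 2) ?lerXn2r ?nnegrE ?(le_trans _ h) //; ring.
  apply: ler_wpM2l; first by apply: mulr_ge0 => //; exact: sqr_ge0.
  rewrite sum_diff_mul sum1 mulr1 ler_wpM2l //.
  rewrite lerBlDr (le_trans (_ : _ <= d * 1)) ?mulr1 ?lerDl // -[leRHS]mulr1 ler_wpM2l // -sum1.
  by apply: ler_sum => j _; rewrite ler_piMr ?weight_ge0 // weight_le1.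
rewrite wsum_sphere // (_ : 16 * r * _ = 8 * r * (2 * \sum_(i in J) l i ^+ 2 * w i x)); last by ring.
set X := \sum_(_ in J) _ ^+ 2 * _.
have X0 : 0 <= X by apply: sumr_ge0 => j _; rewrite mulr_ge0 ?sqr_ge0 ?weight_ge0.
apply: (@le_trans _ _ (8 * (1 - r) * r * (2 * X))).
  by rewrite ler_wpM2l ?mulr_ge0 ?subr_ge0 ?(ltW r0) // ler_wpM2l // lerBlDr lerDl sqr_ge0.
rewrite ler_wpM2r ?mulr_ge0 // ler_wpM2r ?(ltW r0) // ler_piMr // lerBlDr lerDl ltW //.
Qed.

Let tau_unitary k : Q k -> Defs.unitarymx (rot V k.1.1 k.1.2 c (z k.2)).
Proof. by move=> /and3P[_ _ ij]; apply: rot_unitary => //; exact: cz. Qed.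

Let tau_comm k : Q k -> let U := rot V k.1.1 k.1.2 c (z k.2) in U *m P = P *m U.
Proof. by move=> /and3P[iJ jJ ij] /=; rewrite EP; apply: rot_comm => //; rewrite iJ jJ. Qed.

Let mtau k : Q k -> measurable_fun setT (tau k).
Proof. by move=> _; exact: measurable_mulmx. Qed.

Let tauS k : Q k -> tau k @^-1` S = S.
Proof. by move=> Qk; apply: sphere_preimage; [exact: tau_unitary|exact: tau_comm]. Qed.

Let inv k : Q k -> forall A, measurable A -> u (tau k @^-1` A) = u A.
Proof. by move=> Qk A mA; apply: (proj2 unif) => //; [exact: tau_unitary|exact: tau_comm]. Qed.

Let iotaK : involutive iota.
Proof. by case=> [p [b1 b2]]; rewrite /iota /= negbK. Qed.

Let iotaQ k : Q (iota k) = Q k. Proof. by []. Qed.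

Let tauK k x : Q k -> tau (iota k) (tau k x) = x.
Proof.
move=> /and3P[_ _ ij]; rewrite /tau /= zN; apply: rotK => //; exact: cz.
Qed.

Let mS : measurable S := measurable_sphere P.
Let uS : u S = 1%E := proj1 unif.

(** The pair identity with [g = 1]: its left side is 0 and the rate is positive. *)
Lemma wdev_mean0 l : mean u S (wdev l) = 0.
Proof.
have := exchangeable_pair mS uS mtau tauS inv iotaK iotaQ tauK (bmeas_wdev l) (bmeas_cst S 1) (drift l).
rewrite (eq_mean _ (g := fun=> 0)) ?mean_cst //; last first.
  by move=> x _; rewrite big1 // => k _; rewrite subrr mulr0.
rewrite (eq_mean _ (g := wdev l)) => [/esym/eqP|x _]; last by rewrite mulr1.
by rewrite mulf_eq0 [_ * _ == 0]gt_eqF ?mulr_gt0 //= => /eqP.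
Qed.

(** The constant is the bound of [energy], with [b ^+ 2] for the second moment, divided by the rate
    [8 r d]. *)
Lemma wdev_moment l (b : R) m : (forall j, j \in J -> `|l j| <= b) ->
  mean u S (fun x => wdev l x ^+ m.+1.*2) <=
  m.*2.+1%:R * ((4 * r + 2 / d) * b ^+ 2 * mean u S (fun x => wdev l x ^+ m.*2)).
Proof.
move=> lb; have L0 : 0 < 8 * r * d by rewrite !mulr_gt0.
rewrite -(ler_pM2l L0).
have := moment_step mS uS mtau tauS inv iotaK iotaQ tauK (v := 32 * r ^+ 2 * b ^+ 2 * d + 16 * r * b ^+ 2)
   m (bmeas_wdev l) (drift l).
rewrite (_ : 8 * r * d * (_ * _) = m.*2.+1%:R *
 ((32 * r ^+ 2 * b ^+ 2 * d + 16 * r * b ^+ 2) * mean u S (fun x => wdev l x ^+ m.*2))); last first.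
  by field; rewrite gt_eqF.
apply => x Sx; apply: (le_trans (energy Sx lb)); rewrite lerD2l ler_wpM2l ?mulr_ge0 ?(ltW r0) //.
rewrite wsum_sphere // -[leRHS]mulr1 -(proj2 (weight_sphere Sx)) mulr_sumr.
apply: ler_sum => j jJ; rewrite ler_wpM2r ?weight_ge0 // -real_normK ?num_real //.
by rewrite lerXn2r ?nnegrE ?(le_trans _ (lb j jJ)) // lb.
Qed.

(** The pair identity with [g = f], without loss; the mean of the second moment in [energy] comes
    from [wdev_mean0] applied to [l ^+ 2]. *)
Lemma wdev_variance_angle l (b : R) : (forall j, j \in J -> `|l j| <= b) ->
  mean u S (fun x => wdev l x ^+ 2) <= 2 * b ^+ 2 * r + (\sum_(j in J) l j ^+ 2) / d ^+ 2.
Proof.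
move=> lb; have L0 : 0 < 2 * (8 * r * d) by rewrite !mulr_gt0.
rewrite -(ler_pM2l L0).
have := exchangeable_pair mS uS mtau tauS inv iotaK iotaQ tauK (bmeas_wdev l) (bmeas_wdev l) (drift l).
rewrite (eq_mean _ (f := fun x => wdev l x * wdev l x) (g := fun x => wdev l x ^+ 2)) // => <-.
have Ew : mean u S (fun x => \sum_j l j ^+ 2 * w j x) = (\sum_(j in J) l j ^+ 2) / d.
  have := wdev_mean0 (fun j => l j ^+ 2); rewrite /wdev meanB //; last 2 first.
  - exact: bmeas_wsum.
  - exact: bmeas_cst.
  by rewrite mean_cst // => /subr0_eq.
have Eb : mean u S (fun x => 32 * r ^+ 2 * b ^+ 2 * d + 16 * r * \sum_j l j ^+ 2 * w j x) =
    2 * (8 * r * d) * (2 * b ^+ 2 * r + (\sum_(j in J) l j ^+ 2) / d ^+ 2).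
  rewrite meanD //; [|exact: bmeas_cst|exact/bmeasZ/bmeas_wsum].
  rewrite mean_cst // meanZ //; last exact: bmeas_wsum.
  by rewrite Ew; field; rewrite gt_eqF.
rewrite -Eb; apply: le_mean => //.
- apply: bmeas_sum => k Qk; have bt : bmeas S (fun x => wdev l (tau k x)).
    by apply: (bmeas_comp (mtau Qk) (tauS Qk) (bmeas_wdev l)).
  by apply: bmeasM; apply: bmeasB => //; exact: bmeas_wdev.
- by apply: bmeasD; [exact: bmeas_cst|exact/bmeasZ/bmeas_wsum].
- by move=> x Sx; exact: energy.
Qed.

End Angle.

Lemma wdev_variance l :
  mean u S (fun x => wdev l x ^+ 2) <= (\sum_(j in J) l j ^+ 2) / d ^+ 2.
Proof.
pose b := \sum_j `|l j|; have lb j : j \in J -> `|l j| <= b.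
  by move=> _; rewrite /b (bigD1 j) //= lerDl sumr_ge0.
(* The added 1 keeps [q] positive when [b = 0]; the choice of [r] makes the error [2 b^2 r] at most
   [e]. *)
apply/ler_addgt0Pr => e e0; pose q := 2 * b ^+ 2 + 1.
have q0 : 0 < q by rewrite ltr_wpDl // mulr_ge0 // sqr_ge0.
pose r := Num.min 1 (e / q).
have r0 : 0 < r by rewrite lt_min ltr01 divr_gt0.
have r1 : r <= 1 by rewrite ge_min lexx.
apply: (le_trans (wdev_variance_angle r0 r1 lb)); rewrite addrC lerD2l.
apply: (@le_trans _ _ (q * r)); first by rewrite ler_wpM2r ?(ltW r0) // lerDl.
by rewrite mulrC -ler_pdivlMr // ge_min lexx orbT.
Qed.

Lemma wdev_tail l (b eta : R) : 0 < b -> 0 <= eta -> (forall j, j \in J -> `|l j| <= b) ->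
  (u (S `&` [set x | (eta <= `|wdev l x|)%R]) <=
     (2 * expR (- (eta ^+ 2 * d / (24 * b ^+ 2))))%:E)%E.
Proof.
move=> b0 eta0 lb.
have r0 : 0 < d^-1 by rewrite invr_gt0.
have r1 : d^-1 <= 1 by rewrite invf_le1 // ler1n.
(* [wdev_moment] at [r = 1 / d] has the constant [6 b^2 / d]. *)
have c0 : 0 < 6 * b ^+ 2 / d by rewrite divr_gt0 // mulr_gt0 // exprn_gt0.
have -> : eta ^+ 2 * d / (24 * b ^+ 2) = eta ^+ 2 / (4 * (6 * b ^+ 2 / d)).
  by field; rewrite !gt_eqF.
apply: subgaussian_tail => //; [exact: measurable_sphere|exact: (proj1 unif)|exact: bmeas_wdev|].
move=> m; have := wdev_moment r0 r1 m lb.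
by congr (_ <= _ * (_ * _)); field; rewrite gt_eqF.
Qed.

End RotationMoments.

(** * The unitary evolution *)

Section Evolution.
Variable R : realType.

Lemma cvg_sum_seq (I : Type) (s : seq I) (F : I -> R ^nat) (l : I -> R) :
  (forall i, F i m @[m --> \oo] --> l i) ->
  \sum_(i <- s) F i m @[m --> \oo] --> \sum_(i <- s) l i.
Proof.
move=> Fl; elim: s => [|i s IH].
  by rewrite big_nil; under eq_fun do rewrite big_nil; exact: cvg_cst.
by rewrite big_cons; under eq_fun do rewrite big_cons; exact: cvgD.
Qed.

Definition phase (x : R) : R[i] := Complex (cos x) (sin x).

Lemma phase_conj x : Num.conj (phase x) = phase (- x).
Proof. by rewrite conjE /phase /= cosN sinN. Qed.

Lemma phase_mul_conj x : Num.conj (phase x) * phase x = 1.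
Proof. by rewrite csqE /csq /= cos2Dsin2. Qed.

Definition exp_psum (z : R[i]) (m : nat) : R[i] := \sum_(k < m) (k`!%:R)^-1 * z ^+ k.

(** Shaped to match the terms of [cos_coeff] and [sin_coeff]; at [k = 0] the truncated [k.-1] is
    multiplied by 0. *)
Lemma imaginary_exp (x : R) k : (Complex 0 x) ^+ k =
  Complex ((~~ odd k)%:R * (-1) ^+ k./2 * x ^+ k) ((odd k)%:R * (-1) ^+ k.-1./2 * x ^+ k).
Proof.
suff E j : (Complex 0 x) ^+ j.*2 = Complex ((-1) ^+ j * x ^+ j.*2) 0 /\
    (Complex 0 x) ^+ j.*2.+1 = Complex 0 ((-1) ^+ j * x ^+ j.*2.+1).
  rewrite -[k]odd_double_half; case: (odd k); rewrite ?add0n ?add1n.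
    by rewrite (proj2 (E _)) /= odd_double /= doubleK uphalf_double !mul0r !mul1r.
  by rewrite (proj1 (E _)) /= odd_double /= doubleK !mul0r !mul1r.
elim: j => [|j [_ IH]].
  by split; [rewrite !expr0 mulr1|rewrite !expr1 expr0 mul1r].
have IH2 : (Complex 0 x) ^+ j.+1.*2 = Complex ((-1) ^+ j.+1 * x ^+ j.+1.*2) 0.
  rewrite doubleS exprS IH; apply/eqP; rewrite eq_complex /=; apply/andP; split; apply/eqP; rewrite ?exprS; ring.
by split => //; rewrite exprS IH2; apply/eqP; rewrite eq_complex /=; apply/andP; split; apply/eqP; rewrite ?exprS; ring.
Qed.

Lemma Re_exp_psum x m : complex.Re (exp_psum (Complex 0 x) m) = series (cos_coeff x) m.
Proof.
rewrite /exp_psum raddf_sum /series /= big_mkord; apply: eq_bigr => k _.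
rewrite imaginary_exp -(rmorph_nat (real_complex R)) -fmorphV /= mul0r subr0 /cos_coeff /=.
by rewrite mulrC.
Qed.

Lemma Im_exp_psum x m : complex.Im (exp_psum (Complex 0 x) m) = series (sin_coeff x) m.
Proof.
rewrite /exp_psum raddf_sum /series /= big_mkord; apply: eq_bigr => k _.
rewrite imaginary_exp -(rmorph_nat (real_complex R)) -fmorphV /= mul0r addr0 /sin_coeff /=.
by rewrite mulrC.
Qed.

Lemma cvg_Re_exp_psum x : complex.Re (exp_psum (Complex 0 x) m) @[m --> \oo] --> cos x.
Proof.
under eq_fun do rewrite Re_exp_psum.
by rewrite cos.unlock; exact: is_cvg_series_cos_coeff.
Qed.

Lemma cvg_Im_exp_psum x : complex.Im (exp_psum (Complex 0 x) m) @[m --> \oo] --> sin x.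
Proof.
under eq_fun do rewrite Im_exp_psum.
by rewrite sin.unlock; exact: is_cvg_series_sin_coeff.
Qed.

Variable n : nat.

Lemma exp_diag_conj (V : 'M[R[i]]_n) (z : 'I_n -> R[i]) k : V *m adjmx V = 1%:M -> adjmx V *m V = 1%:M ->
  (adjmx V *m diag_mx (\row_a z a) *m V) ^+ k = adjmx V *m diag_mx (\row_a z a ^+ k) *m V.
Proof.
move=> VV VV'; elim: k => [|k IH].
  rewrite expr0; have -> : diag_mx (\row_a z a ^+ 0) = 1%:M :> 'M[R[i]]_n.
    by apply/matrixP => a b; rewrite !mxE expr0.
  by rewrite mulmx1 VV'.
rewrite exprS IH -[LHS]/(_ *m _) !mulmxA -[_ *m V *m adjmx V]mulmxA VV mulmx1.
rewrite -[_ *m diag_mx _ *m diag_mx _]mulmxA mulmx_diag; congr (_ *m diag_mx _ *m _).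
by apply/rowP => a; rewrite !mxE exprS.
Qed.

Lemma conj_diagE (V : 'M[R[i]]_n) (z : 'I_n -> R[i]) i j :
  (adjmx V *m diag_mx (\row_a z a) *m V) i j = \sum_a (Num.conj (V a i) * V a j) * z a.
Proof.
rewrite mxE; apply: eq_bigr => a _; rewrite mul_mx_diag !mxE; ring.
Qed.

(** In the eigenbasis each entry of a partial sum is a fixed linear combination of scalar partial
    sums, and these converge to cosine and sine. *)
Lemma expmx_imaginary (V : 'M[R[i]]_n) (x : 'I_n -> R) : V *m adjmx V = 1%:M -> adjmx V *m V = 1%:M ->
  expmx (adjmx V *m diag_mx (\row_a Complex 0 (x a)) *m V) =
  adjmx V *m diag_mx (\row_a phase (x a)) *m V.
Proof.
move=> VV VV'; have E m i j : expmx_psum (adjmx V *m diag_mx (\row_a Complex 0 (x a)) *m V) m i j =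
    \sum_a (Num.conj (V a i) * V a j) * exp_psum (Complex 0 (x a)) m.
  rewrite /expmx_psum summxE /exp_psum; under [RHS]eq_bigr do rewrite mulr_sumr.
  rewrite exchange_big /=; apply: eq_bigr => k _.
  rewrite mxE exp_diag_conj // conj_diagE mulr_sumr; apply: eq_bigr => a _; ring.
apply/matrixP => i j; rewrite conj_diagE mxE.
apply/eqP; rewrite eq_complex /=; apply/andP; split; apply/eqP.
  under eq_fun do rewrite E raddf_sum /=.
  rewrite raddf_sum; apply: cvg_lim => //; apply: cvg_sum_seq => a /=.
  rewrite ReM; under eq_fun do rewrite ReM.
  by apply: cvgB; apply: cvgM; [exact: cvg_cst|exact: cvg_Re_exp_psum|exact: cvg_cst|exact: cvg_Im_exp_psum].
under eq_fun do rewrite E raddf_sum /=.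
rewrite raddf_sum; apply: cvg_lim => //; apply: cvg_sum_seq => a /=.
rewrite ImM; under eq_fun do rewrite ImM.
by apply: cvgD; apply: cvgM; [exact: cvg_cst|exact: cvg_Im_exp_psum|exact: cvg_cst|exact: cvg_Re_exp_psum].
Qed.

Lemma evol_spectral (H : 'M[R[i]]_n) : selfadjoint H ->
  exists (V : 'M[R[i]]_n) (l : 'I_n -> R),
    [/\ V *m adjmx V = 1%:M, adjmx V *m V = 1%:M &
      forall t, evol H t = adjmx V *m diag_mx (\row_a phase (- (t * l a))) *m V].
Proof.
move=> hH; have [|V [l [_ [VV VV' EH _]]]] := codiag hH (adjmx1 R n).
  by rewrite mulmx1 mul1mx.
exists V, l; split; [exact: VV|exact: VV'|move=> t].
rewrite -(expmx_imaginary (fun a => - (t * l a)) VV VV') /evol.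
suff -> : Complex 0 (- t) *: H =
    adjmx V *m diag_mx (\row_a Complex 0 (- (t * l a))) *m V by [].
rewrite EH scalemxAl scalemxAr.
suff -> : Complex 0 (- t) *: diag_mx (\row_i (l i)%:C) =
    diag_mx (\row_a Complex 0 (- (t * l a))) by [].
apply/matrixP => a b; rewrite !mxE mulrnAr; congr (_ *+ _).
by apply/eqP; rewrite eq_complex /=; apply/andP; split; apply/eqP; ring.
Qed.

Lemma evol_adj (H : 'M[R[i]]_n) t : selfadjoint H -> adjmx (evol H t) = evol H (- t).
Proof.
move=> /evol_spectral[V [l [VV VV' E]]]; rewrite !E !adjmxM adjmxK mulmxA; congr (_ *m _ *m _).
apply/matrixP => a b; rewrite adjmxE !mxE rmorphMn /= phase_conj mulNr.
by have [->//|_] := eqVneq b a.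
Qed.

Lemma evol_unitary (H : 'M[R[i]]_n) t : selfadjoint H -> adjmx (evol H t) *m evol H t = 1%:M.
Proof.
move=> /evol_spectral[V [l [VV VV' E]]]; rewrite !E !adjmxM adjmxK.
rewrite !mulmxA -[_ *m V *m adjmx V]mulmxA VV mulmx1 -[_ *m _ *m diag_mx _]mulmxA.
rewrite (_ : adjmx _ *m diag_mx _ = 1%:M) ?mulmx1 //.
apply/matrixP => a b; rewrite mul_mx_diag !mxE rmorphMn /= mulrnAl eq_sym.
by congr (_ *+ _); exact: phase_mul_conj.
Qed.

Lemma cmeas_evol (H : 'M[R[i]]_n) i j : selfadjoint H ->
  cmeas (fun t : measurableTypeR R => evol H t i j).
Proof.
move=> /evol_spectral[V [l [VV VV' E]]].
rewrite (_ : (fun t => _) = (fun t : measurableTypeR R => \sum_a (Num.conj (V a i) * V a j) * phase (- (t * l a)))).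
  apply: cmeas_sum => a; apply: cmeasM; first exact: cmeas_cst.
  have ml : measurable_fun setT (fun t : measurableTypeR R => - (t * l a)).
    by apply: measurableT_comp => //; exact: measurable_funM.
  split.
    exact: (measurableT_comp (continuous_measurable_fun (@continuous_cos R)) ml).
  exact: (measurableT_comp (continuous_measurable_fun (@continuous_sin R)) ml).
by apply/funext => t; rewrite E conj_diagE.
Qed.

End Evolution.

(** * Operator norm, Hilbert-Schmidt norm and trace norm *)

Section Norms.
Variables (R : realType) (n : nat).
Implicit Types (A B M P S U V X : 'M[R[i]]_n) (x y : 'cV[R[i]]_n).

Definition nsq x : R := \sum_k csq (x k 0).

Lemma nsq_ge0 x : 0 <= nsq x. Proof. by apply: sumr_ge0 => k _; exact: csq_ge0. Qed.

Lemma dotc_nsq x : dotc x x = (nsq x)%:C. Proof. exact: dotc_sqr. Qed.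

Lemma dotc_adj_mul A x : dotc x (adjmx A *m A *m x) = (nsq (A *m x))%:C.
Proof. by rewrite -mulmxA dotc_adj adjmxK dotc_nsq. Qed.

Lemma nsq_unitary U x : adjmx U *m U = 1%:M -> nsq (U *m x) = nsq x.
Proof. by move=> UU; apply: complexI; rewrite -dotc_adj_mul UU mul1mx dotc_nsq. Qed.

Definition basis_vec V (j : 'I_n) : 'cV[R[i]]_n := adjmx V *m delta_mx j 0.

Lemma weight_basis_vec V i j : V *m adjmx V = 1%:M ->
  weight V i (basis_vec V j) = (i == j)%:R.
Proof.
move=> VV; rewrite /weight /basis_vec mulmxA VV mul1mx mxE andbT.
by case: (i == j); rewrite /csq /= ?expr1n ?expr0n ?addr0.
Qed.

Lemma nsq_basis_vec V j : V *m adjmx V = 1%:M -> nsq (basis_vec V j) = 1.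
Proof.
move=> VV; apply: complexI; rewrite -dotc_nsq (weight_sum _ (mulmx1C VV)).
congr (_%:C); rewrite (bigD1 j) //= weight_basis_vec // eqxx big1 ?addr0 // => i /negbTE ij.
by rewrite weight_basis_vec // ij.
Qed.

Lemma dotc_basis_vec V (l : 'I_n -> R) j : V *m adjmx V = 1%:M ->
  dotc (basis_vec V j) (adjmx V *m rdiag l *m V *m basis_vec V j) = (l j)%:C.
Proof.
move=> VV; rewrite dotc_rdiag; congr (_%:C).
rewrite (bigD1 j) //= weight_basis_vec // eqxx mulr1 big1 ?addr0 // => i /negbTE ij.
by rewrite weight_basis_vec // ij mulr0.
Qed.

Lemma herm_diag A : adjmx A = A -> exists (V : 'M[R[i]]_n) (l : 'I_n -> R),
  [/\ V *m adjmx V = 1%:M, adjmx V *m V = 1%:M & A = adjmx V *m rdiag l *m V].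
Proof.
move=> hA; have [|V [l [_ [VV VV' EA _]]]] := codiag hA (adjmx1 R n).
  by rewrite mulmx1 mul1mx.
by exists V, l.
Qed.

Lemma adj_mul_herm B : adjmx (adjmx B *m B) = adjmx B *m B.
Proof. by rewrite adjmxM adjmxK. Qed.

Lemma vnormE x : vnorm x = Num.sqrt (nsq x).
Proof. by rewrite /vnorm dotc_nsq. Qed.

(** Gives the set in [opnorm] an upper bound, so that its [sup] dominates its elements. The weights
    of a unit vector in an eigenbasis of [B^dagger B] are at most 1. *)
Lemma nsq_bounded B : exists C, forall x, nsq x = 1 -> nsq (B *m x) <= C.
Proof.
have [V [l [VV VV' E]]] := herm_diag (adj_mul_herm B).
exists (\sum_j `|l j|) => x x1.
have -> : nsq (B *m x) = \sum_j l j * weight V j x.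
  by apply: complexI; rewrite -dotc_adj_mul E dotc_rdiag.
apply: ler_sum => j _; rewrite (le_trans (ler_norm _)) // normrM (ger0_norm (weight_ge0 V j x)).
have w1 : weight V j x <= nsq x.
  have -> : nsq x = \sum_j weight V j x.
    by apply: complexI; rewrite -dotc_nsq (weight_sum _ VV').
  by rewrite (bigD1 j) //= lerDl sumr_ge0 // => k _; exact: weight_ge0.
by apply: ler_piMr => //; rewrite -x1.
Qed.

Lemma nsq_opnorm B x : nsq x = 1 -> 0 <= opnorm B /\ nsq (B *m x) <= opnorm B ^+ 2.
Proof.
move=> x1; have le : vnorm (B *m x) <= opnorm B.
  apply: ub_le_sup; last by exists x => //=; rewrite vnormE x1 sqrtr1.
  have [C hC] := nsq_bounded B; exists (Num.sqrt C) => _ [y /= y1 <-].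
  rewrite vnormE ler_wsqrtr // hC //.
  by move: y1; rewrite vnormE => /(congr1 (fun r => r ^+ 2)); rewrite sqr_sqrtr ?nsq_ge0 // expr1n.
have b0 : 0 <= opnorm B by rewrite (le_trans _ le) // vnormE sqrtr_ge0.
split => //; rewrite -[nsq _]sqr_sqrtr ?nsq_ge0 // -vnormE.
by rewrite lerXn2r ?nnegrE // vnormE sqrtr_ge0.
Qed.

(** Cauchy-Schwarz from [0 <= nsq (b x + y)] and [0 <= nsq (- b x + y)], divided by [b]; for [b = 0]
    the vector [y] is zero. *)
Lemma Re_dotc_le (b : R) x y : 0 <= b -> nsq x = 1 -> nsq y <= b ^+ 2 ->
  `|complex.Re (dotc x y)| <= b.
Proof.
move=> b0 x1 yb; rewrite le_eqVlt in b0; case/predU1P: b0 => [b0|b0].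
  have y0 : nsq y = 0 by apply/eqP; rewrite eq_le nsq_ge0 andbT (le_trans yb) // -b0 expr0n.
  rewrite (_ : dotc x y = 0) ?normr0 -?b0 // dotcE big1 // => k _.
  have /eqP := y0; rewrite psumr_eq0 => [/allP/(_ k (mem_index_enum _))|i _]; last exact: csq_ge0.
  by rewrite /= csq_eq0 => /eqP ->; rewrite mulr0.
have exp (c : R) : nsq (c%:C *: x + y) = c ^+ 2 + 2 * c * complex.Re (dotc x y) + nsq y.
  rewrite -[c ^+ 2]mulr1 -[X in _ ^+ 2 * X]x1 dotcE raddf_sum /nsq !mulr_sumr -!big_split /=.
  apply: eq_bigr => k _; rewrite !mxE conjE; case: (x k 0) (y k 0) => [p q] [p' q'].
  by rewrite /csq /=; ring.
have h1 := nsq_ge0 (b%:C *: x + y); have h2 := nsq_ge0 ((- b)%:C *: x + y).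
move: h1 h2; rewrite !exp; move: (complex.Re _) yb => r yb h1 h2.
rewrite ler_norml; apply/andP; split; rewrite -(ler_pM2l b0); nra.
Qed.

(** The square of the Hilbert-Schmidt norm. *)
Definition hs X : R := \sum_i \sum_j csq (X i j).

Lemma hs_tr X : \tr (adjmx X *m X) = (hs X)%:C.
Proof.
rewrite /hs exchange_big /= rmorph_sum; apply: eq_bigr => j _.
rewrite mxE rmorph_sum; apply: eq_bigr => i _; rewrite adjmxE; exact: csqE.
Qed.

Lemma hs_adj X : hs (adjmx X) = hs X.
Proof.
rewrite /hs exchange_big; apply: eq_bigr => i _; apply: eq_bigr => j _.
by rewrite adjmxE csqJ.
Qed.

Lemma hs_rdiag V l : V *m adjmx V = 1%:M -> adjmx V *m V = 1%:M ->
  hs (adjmx V *m rdiag l *m V) = \sum_j l j ^+ 2.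
Proof.
move=> VV VV'; apply: complexI; rewrite -hs_tr.
have -> : adjmx (adjmx V *m rdiag l *m V) = adjmx V *m rdiag l *m V.
  rewrite !adjmxM adjmxK mulmxA; congr (_ *m _ *m _).
  apply/matrixP => i j; rewrite adjmxE !mxE rmorphMn /= conjE conjc_real.
  by have [->|//] := eqVneq j i.
rewrite !mulmxA -[_ *m V *m adjmx V]mulmxA VV mulmx1 -[_ *m _ *m rdiag l]mulmxA rdiag_mul.
by rewrite trace_rdiag.
Qed.

Lemma hs_unitary U B : U *m adjmx U = 1%:M -> hs (adjmx U *m B *m U) = hs B.
Proof.
move=> UU; apply: complexI; rewrite -!hs_tr !adjmxM adjmxK.
have -> : adjmx U *m (adjmx B *m U) *m (adjmx U *m B *m U) = adjmx U *m (adjmx B *m B *m U).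
  by rewrite !mulmxA -[_ *m U *m adjmx U]mulmxA UU mulmx1.
by rewrite [LHS]mxtrace_mulC -[_ *m U *m _]mulmxA UU mulmx1.
Qed.

Lemma nsq_col X j : nsq (col j X) = \sum_i csq (X i j).
Proof. by apply: eq_bigr => i _; rewrite mxE. Qed.

Lemma diag_entry V G j :
  (V *m G *m adjmx V) j j = dotc (basis_vec V j) (G *m basis_vec V j).
Proof.
rewrite /dotc /basis_vec adjmxM adjmxK.
have -> : adjmx (delta_mx j 0 : 'cV[R[i]]_n) = delta_mx 0 j.
  apply/matrixP => a b; rewrite adjmxE !mxE andbC.
  by case: (_ && _); rewrite ?conjC1 ?conjC0.
by rewrite !mulmxA -!mulmxA -rowE !mulmxA -colE !mxE.
Qed.

Lemma nsq_proj P x : orthoproj P -> nsq (P *m x) <= nsq x.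
Proof.
move=> oP; have [hP PP] := oP.
have e : nsq x = nsq (P *m x) + nsq (x - P *m x).
  apply: complexI; rewrite rmorphD /= -!dotc_nsq.
  have pd y z : dotc (y - z) (y - z) = dotc y y - dotc y z - dotc z y + dotc z z.
    rewrite !dotcE -!sumrB -big_split /=; apply: eq_bigr => k _.
    by rewrite !mxE rmorphB /=; ring.
  rewrite pd; have -> : dotc (P *m x) x = dotc x (P *m x) by rewrite dotc_adj hP.
  have -> : dotc (P *m x) (P *m x) = dotc x (P *m x) by rewrite dotc_adj hP mulmxA PP dotc_adj hP.
  by ring.
by rewrite e lerDl nsq_ge0.
Qed.

Lemma hs_proj P X : orthoproj P -> hs (P *m X) <= hs X.
Proof.
move=> oP; rewrite /hs exchange_big [leRHS]exchange_big /=.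
by apply: ler_sum => j _; rewrite -!nsq_col !colE -mulmxA nsq_proj.
Qed.

(* The trace of [X^dagger X P] is computed in an orthonormal basis of the range of [P]. *)
Lemma hs_mulr_proj P X (b : R) : orthoproj P ->
  (forall x, nsq x = 1 -> nsq (X *m x) <= b) -> hs (X *m P) <= (\rank P)%:R * b.
Proof.
move=> oP Xb; have [hP PP] := oP.
have [V [_ [J [[VV VV'] _ EP cJ _]]]] := projection_frame hP oP PP.
suff -> : hs (X *m P) = \sum_(j in J) nsq (X *m basis_vec V j).
  rewrite -cJ mulr_natl -sumr_const; apply: ler_sum => j _.
  by rewrite Xb // nsq_basis_vec.
apply: complexI; rewrite -hs_tr adjmxM hP.
have -> : P *m adjmx X *m (X *m P) = P *m (adjmx X *m X *m P) by rewrite !mulmxA.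
have -> : \tr (P *m (adjmx X *m X *m P)) =
    \tr (V *m (adjmx X *m X) *m adjmx V *m rdiag (fun j => (j \in J)%:R)).
  rewrite [LHS]mxtrace_mulC -[_ *m P *m P]mulmxA PP {1}EP !mulmxA.
  by rewrite [LHS]mxtrace_mulC !mulmxA.
rewrite /mxtrace rmorph_sum /= [RHS]big_mkcond /=; apply: eq_bigr => j _.
rewrite mul_mx_diag mxE [in X in _ * X]mxE diag_entry dotc_adj_mul.
by case: ifP => jJ; rewrite ?mulr1 ?mulr0.
Qed.

(** The [s j] are the singular values of [B]: on a unit eigenvector [v] of [absmx B], [|B v|^2] is
    [s j ^+ 2], hence the bound by [opnorm B]. *)
Lemma trnormE B : exists s : 'I_n -> R, [/\ trnorm B = \sum_j s j,
  hs B = \sum_j s j ^+ 2 & forall j, 0 <= s j <= opnorm B].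
Proof.
(* [xget] would default to 0 without a witness; the root is built from square roots of the
   eigenvalues of [B^dagger B]. *)
have mean : exists S, psd S /\ S *m S = adjmx B *m B.
  have [V [l [VV VV' E]]] := herm_diag (adj_mul_herm B).
  have l0 j : 0 <= l j.
    by rewrite -lecR -(dotc_basis_vec l j VV) -E dotc_adj_mul lecR nsq_ge0.
  exists (adjmx V *m rdiag (fun j => Num.sqrt (l j)) *m V); split; first split.
  - rewrite !adjmxM adjmxK mulmxA; congr (_ *m _ *m _).
    apply/matrixP => i j; rewrite adjmxE !mxE rmorphMn /= conjE conjc_real.
    by have [->|//] := eqVneq j i.
  - move=> v; rewrite dotc_rdiag lecR; apply: sumr_ge0 => j _.
    by rewrite mulr_ge0 ?sqrtr_ge0 ?weight_ge0.
  - rewrite E !mulmxA -[_ *m V *m adjmx V]mulmxA VV mulmx1 -[_ *m _ *m rdiag _]mulmxA rdiag_mul.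
    by congr (_ *m rdiag _ *m _); apply/funext => j; rewrite -expr2 sqr_sqrtr.
have [[hS S0] SS] : psd (absmx B) /\ absmx B *m absmx B = adjmx B *m B.
  exact: (@xgetPex _ 0 [set S : 'M[R[i]]_n | psd S /\ S *m S = adjmx B *m B] mean).
have [V [s [VV VV' E]]] := herm_diag hS.
have s0 j : 0 <= s j by rewrite -lecR -(dotc_basis_vec s j VV) -E S0.
exists s; split.
- by rewrite /trnorm E trace_rdiag.
- by rewrite -(hs_rdiag s VV VV') -E; apply: complexI; rewrite -!hs_tr hS SS.
move=> j; rewrite s0 /=.
have [b0 nb] := nsq_opnorm B (nsq_basis_vec j VV).
rewrite -(ler_sqr) ?nnegrE //; apply: le_trans nb.
rewrite le_eqVlt; apply/predU1P; left; apply: complexI.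
have SS2 : adjmx B *m B = adjmx V *m rdiag (fun i => s i * s i) *m V.
  rewrite -SS E !mulmxA -[_ *m V *m adjmx V]mulmxA VV mulmx1.
  by rewrite -[_ *m _ *m rdiag _]mulmxA rdiag_mul.
by rewrite -dotc_adj_mul SS2 dotc_basis_vec.
Qed.

End Norms.

(** * Deviation of the expectation value *)

Section Decomposition.
Variables (R : realType) (n : nat).
Implicit Types (A B P V X : 'M[R[i]]_n) (x y : 'cV[R[i]]_n).

Definition frame P V (J : {set 'I_n}) :=
  [/\ V *m adjmx V = 1%:M, adjmx V *m V = 1%:M,
      P = adjmx V *m rdiag (fun j => (j \in J)%:R) *m V & #|J| = \rank P].

Let imu : R[i] := Complex 0 1.

(** The parallelogram law, entry by entry, makes [hs] additive over the two parts, so the splitting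
    costs nothing in the variance. *)
Lemma herm_parts X : exists A1 A2,
  [/\ adjmx A1 = A1, adjmx A2 = A2, X = A1 + imu *: A2,
      hs A1 + hs A2 = hs X &
      forall P, adjmx P = P -> X *m P = X -> P *m X = X -> A1 *m P = A1 /\ A2 *m P = A2].
Proof.
have h2 : (2%:R : R[i]) != 0 by rewrite pnatr_eq0.
exists (2^-1 *: (X + adjmx X)), ((2^-1 * - imu) *: (X - adjmx X)).
have hN : - adjmx X = adjmx (- X) by apply/matrixP => i j; rewrite adjmxE !mxE rmorphN.
have c2 : Num.conj (2^-1 : R[i]) = 2^-1 by rewrite fmorphV /= rmorph_nat.
have ci : Num.conj (- imu) = imu by rewrite conjE /imu; apply/eqP; rewrite eq_complex /= !(oppr0, opprK) !eqxx.
have ii : imu * imu = -1 by apply/eqP; rewrite eq_complex /=; apply/andP; split; apply/eqP; ring.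
split.
- by rewrite adjmxZ adjmxD adjmxK c2 addrC.
- rewrite adjmxZ rmorphM /= c2 ci hN adjmxD adjmxK -hN.
  by apply/matrixP => i j; rewrite !mxE; ring.
- apply/matrixP => i j; rewrite !mxE; rewrite mulrA mulrCA mulrN ii opprK mulr1.
  by field.
- have E : hs X = 2^-1 * (hs X + hs (adjmx X)) by rewrite hs_adj; field.
  rewrite E /hs -!big_split mulr_sumr /=; apply: eq_bigr => i _.
  rewrite -!big_split mulr_sumr /=; apply: eq_bigr => j _; rewrite !mxE.
  have half : (2^-1 : R[i]) = Complex 2^-1 0.
    by rewrite -(rmorph_nat (real_complex R) 2) -fmorphV.
  rewrite half /imu conjE; case: (X i j) (X j i) => [a b] [a' b'].
  by rewrite /csq /=; field.
- move=> P hP XP PX; have XaP : adjmx X *m P = adjmx X by rewrite -{1}hP -adjmxM PX.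
  by rewrite -!scalemxAl !mulmxDl mulNmx XP XaP.
Qed.

Lemma frame_fix P V J j : frame P V J -> j \in J -> P *m basis_vec V j = basis_vec V j.
Proof.
move=> [VV _ EP _] jJ; rewrite EP /basis_vec -!mulmxA [V *m (adjmx V *m _)]mulmxA VV mul1mx.
congr (_ *m _); apply/colP => k; rewrite mul_diag_mx !mxE.
by have [->|_] := eqVneq k j; rewrite ?jJ ?mul1r // mulr0.
Qed.

Lemma sum_frame (J : {set 'I_n}) (l : 'I_n -> R) (F : R -> R) : F 0 = 0 ->
  (forall j, j \notin J -> l j = 0) -> \sum_j F (l j) = \sum_(j in J) F (l j).
Proof.
move=> F0 off; rewrite [RHS]big_mkcond; apply: eq_bigr => j _.
by case: ifPn => // /off ->.
Qed.

(** The Hermitian parts carry the real and imaginary parts of the expectation, so the squared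
    modulus is a sum of two squared real deviations. They need not commute, hence two frames. Each
    eigenvalue is a component of [dotc v (X *m v)] at a unit eigenvector [v] in the range of [P]. *)
Lemma deviation_frames P X : orthoproj P -> X *m P = X -> P *m X = X ->
  exists V1 l1 J1 V2 l2 J2, 
  [/\ frame P V1 J1 /\ frame P V2 J2,
      forall x : 'cV[R[i]]_n, csq (dotc x (X *m x) - (\rank P)%:R^-1 * \tr X) =
        wdev V1 J1 l1 x ^+ 2 + wdev V2 J2 l2 x ^+ 2,
      \sum_(j in J1) l1 j ^+ 2 + \sum_(j in J2) l2 j ^+ 2 = hs X &
      forall b, 0 <= b ->
        (forall x, nsq x = 1 -> P *m x = x -> nsq (X *m x) <= b ^+ 2) ->
        (forall j, j \in J1 -> `|l1 j| <= b) /\ (forall j, j \in J2 -> `|l2 j| <= b)].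
Proof.
move=> oP XP PX; have [hP PP] := oP.
have [A1 [A2 [hA1 hA2 EX hsX hAP]]] := herm_parts X.
have [A1P A2P] := hAP P hP XP PX.
have [V1 [l1 [J1 [[VV1 VV1'] EA1 EP1 cJ1 off1]]]] := projection_frame hA1 oP A1P.
have [V2 [l2 [J2 [[VV2 VV2'] EA2 EP2 cJ2 off2]]]] := projection_frame hA2 oP A2P.
have dotX x : dotc x (X *m x) =
    Complex (\sum_j l1 j * weight V1 j x) (\sum_j l2 j * weight V2 j x).
  rewrite EX mulmxDl -scalemxAl dotcDr dotcZr {1}EA1 {1}EA2 !dotc_rdiag.
  by apply/eqP; rewrite eq_complex /=; apply/andP; split; apply/eqP; ring.
exists V1, l1, J1, V2, l2, J2; split.
- by [].
- move=> x; have trX : \tr X = Complex (\sum_(j in J1) l1 j) (\sum_(j in J2) l2 j).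
    rewrite EX linearD linearZ /= {1}EA1 {1}EA2 !trace_rdiag //.
    rewrite -(sum_frame (F := id) _ off1) // -(sum_frame (F := id) _ off2) //.
    by apply/eqP; rewrite eq_complex /=; apply/andP; split; apply/eqP; ring.
  rewrite dotX trX -(rmorph_nat (real_complex R)) -fmorphV /wdev /wmean cJ1 cJ2.
  by rewrite /csq /=; congr (_ ^+ 2 + _ ^+ 2); ring.
- rewrite -hsX EA1 EA2 !hs_rdiag //.
  by rewrite (sum_frame (F := fun r => r ^+ 2) _ off1) ?expr0n // (sum_frame (F := fun r => r ^+ 2) _ off2) ?expr0n.
move=> b b0 Xb; split => j jJ.
- have e1 := nsq_basis_vec j VV1.
  have fe : P *m basis_vec V1 j = basis_vec V1 j by apply: frame_fix jJ.
  have := Re_dotc_le b0 e1 (Xb _ e1 fe); rewrite dotX /=.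
  have := dotc_basis_vec l1 j VV1; rewrite dotc_rdiag => -[->] //.
- have e1 := nsq_basis_vec j VV2.
  have fe : P *m basis_vec V2 j = basis_vec V2 j by apply: frame_fix jJ.
  (* Multiplication by [-i] turns the imaginary part into a real part, as [Re_dotc_le] expects. *)
  have nE y : nsq (- imu *: y) = nsq y.
    apply: eq_bigr => k _; rewrite !mxE; case: (y k 0) => p q.
    by rewrite /csq /imu /=; ring.
  have := Re_dotc_le (y := - imu *: (X *m basis_vec V2 j)) b0 e1.
  rewrite nE dotcZr dotX => /(_ (Xb _ e1 fe)) /=.
  rewrite oppr0 mul0r add0r mulN1r opprK.
  have := dotc_basis_vec l2 j VV2; rewrite dotc_rdiag => -[->] //.
Qed.

End Decomposition.

(** * The evolved observable compressed to the macro space *)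

Section Deviation.
Variables (R : realType) (n : nat) (P H B : 'M[R[i]]_n).
Hypotheses (oP : orthoproj P) (P0 : (0 < \rank P)%N) (hH : selfadjoint H).
Local Notation d := ((\rank P)%:R : R).
Local Notation S := (sphere P : set (CV R n)).
Local Notation b := (opnorm B).

Let dgt0 : 0 < d. Proof. by rewrite ltr0n. Qed.

Definition heisenberg t := adjmx (evol H t) *m B *m evol H t.
(** Makes the problem static: on the range of [P] it has the expectation of [B] at time [t], and its
    trace over [d] is [wmuB]. *)
Definition compressed t := P *m heisenberg t *m P.

Lemma rank_unit_vector : exists x : 'cV[R[i]]_n, nsq x = 1.
Proof.
case: n P P0 => [Q|m Q _]; first by rewrite flatmx0 mxrank0.
by exists (basis_vec 1%:M ord0); apply: nsq_basis_vec; rewrite adjmx1 mulmx1.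
Qed.

Lemma opnorm_ge0 : 0 <= b.
Proof. by have [x x1] := rank_unit_vector; have [] := nsq_opnorm B x1. Qed.

Lemma heisenberg_bound t x : nsq x = 1 -> nsq (heisenberg t *m x) <= b ^+ 2.
Proof.
have UU := evol_unitary t hH; move=> x1.
rewrite /heisenberg -!mulmxA nsq_unitary ?adjmxK ?(mulmx1C UU) //.
by apply: (proj2 (nsq_opnorm _ _)); rewrite nsq_unitary.
Qed.

Lemma compressed_bound t x : nsq x = 1 -> P *m x = x -> nsq (compressed t *m x) <= b ^+ 2.
Proof.
move=> x1 Px; move: (heisenberg_bound t x1); rewrite /compressed.
move: (heisenberg t) => M Mb; rewrite -!mulmxA Px.
exact: le_trans (nsq_proj _ oP) Mb.
Qed.

Lemma hs_compressed_le_rank t : hs (compressed t) <= d * b ^+ 2.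
Proof.
have := @heisenberg_bound t; rewrite /compressed.
move: (heisenberg t) => M Mb; rewrite -mulmxA; apply: le_trans (hs_proj _ oP) _.
exact: hs_mulr_proj.
Qed.

(** Compression does not increase [hs], evolution preserves it, and singular values satisfy
    [s^2 <= opnorm B * s]. *)
Lemma hs_compressed_le_trnorm t : hs (compressed t) <= b * trnorm B.
Proof.
have UU := evol_unitary t hH.
apply: (@le_trans _ _ (hs B)).
  have <- : hs (heisenberg t) = hs B by rewrite hs_unitary // (mulmx1C UU).
  rewrite /compressed; move: (heisenberg t) => M.
  rewrite -mulmxA; apply: le_trans (hs_proj _ oP) _.
  rewrite -hs_adj adjmxM (proj1 oP); apply: le_trans (hs_proj _ oP) _.
  by rewrite hs_adj.
have [s [-> -> sb]] := trnormE B; rewrite mulr_sumr; apply: ler_sum => j _.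
by have /andP[s0 s1] := sb j; rewrite expr2 ler_wpM2r.
Qed.

Lemma trnorm_ge0 : 0 <= trnorm B.
Proof. by have [s [-> _ sb]] := trnormE B; apply: sumr_ge0 => j _; have /andP[] := sb j. Qed.

Lemma dev_ge0 x t : 0 <= dev P H B x t.
Proof. exact: sqrtr_ge0. Qed.

Lemma dev_sqr t (x : 'cV[R[i]]_n) : P *m x = x ->
  dev P H B x t ^+ 2 = csq (dotc x (compressed t *m x) - (\rank P)%:R^-1 * \tr (compressed t)).
Proof.
move=> Px; rewrite /dev cabsE; congr (csq (_ - _)).
  have -> : dotc x (compressed t *m x) = dotc x (heisenberg t *m x).
    rewrite /compressed; move: (heisenberg t) => M.
    by rewrite -!mulmxA Px [LHS]dotc_adj (proj1 oP) Px.
  rewrite /heisenberg -!mulmxA.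
  by rewrite [RHS]dotc_adj adjmxK.
rewrite /wmuB -evol_adj //; congr (_ * _).
by rewrite /compressed [RHS]mxtrace_mulC mulmxA (proj2 oP) /heisenberg !mulmxA.
Qed.

(** Joint measurability in state and time, as Tonelli's theorem requires. *)
Lemma cmeas_dev :
  cmeas (fun p : CV R n * measurableTypeR R =>
    let psit := evol H p.2 *m (p.1 : 'cV[R[i]]_n) in dotc psit (B *m psit) - wmuB P H B p.2).
Proof.
have mfst (f : CV R n -> R[i]) : cmeas f -> cmeas (fun p : CV R n * measurableTypeR R => f p.1).
  by move=> [f1 f2]; split; [exact: (measurableT_comp f1 measurable_fst)|exact: (measurableT_comp f2 measurable_fst)].
have msnd (f : measurableTypeR R -> R[i]) : cmeas f -> cmeas (fun p : CV R n * measurableTypeR R => f p.2).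
  by move=> [f1 f2]; split; [exact: (measurableT_comp f1 measurable_snd)|exact: (measurableT_comp f2 measurable_snd)].
have mpsi i : cmeas (fun p : CV R n * measurableTypeR R => (evol H p.2 *m (p.1 : 'cV[R[i]]_n)) i 0).
  apply: (cmeas_mulmx (A := fun p : CV R n * measurableTypeR R => evol H p.2) (B := fun p => (p.1 : 'cV[R[i]]_n))).
    by move=> k l; apply: (msnd (fun t => evol H t k l)); exact: cmeas_evol.
  by move=> k l; rewrite (ord1 l); apply: (mfst (fun x : CV R n => (x : 'cV[R[i]]_n) k 0)); exact: cmeas_coord.
have mB : cmeas (fun p : CV R n * measurableTypeR R => wmuB P H B p.2).
  rewrite (_ : (fun p => _) = fun p : CV R n * measurableTypeR R => d%:C^-1 * \sum_i (P *m evol H (- p.2) *m B *m evol H p.2) i i); last first.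
    by apply/funext => p; rewrite /wmuB -(rmorph_nat (real_complex R)).
  apply: (msnd (fun t => d%:C^-1 * \sum_i (P *m evol H (- t) *m B *m evol H t) i i)).
  apply: cmeasM; first exact: cmeas_cst.
  apply: cmeas_sum => i.
  apply: (cmeas_mulmx (A := fun t : measurableTypeR R => P *m evol H (- t) *m B) (B := fun t : measurableTypeR R => evol H t)) => [k l|k l]; last exact: cmeas_evol.
  apply: (cmeas_mulmx (A := fun t : measurableTypeR R => P *m evol H (- t)) (B := fun t : measurableTypeR R => B)) => [{}k {}l|? ?]; last exact: cmeas_cst.
  apply: (cmeas_mulmx (A := fun t : measurableTypeR R => P) (B := fun t : measurableTypeR R => evol H (- t))) => [{}k {}l|{}k {}l]; first exact: cmeas_cst.
  rewrite (_ : (fun t => _) = fun t : measurableTypeR R => Num.conj (evol H t l k)).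
    by apply: cmeasJ; exact: cmeas_evol.
  by apply/funext => t; rewrite -evol_adj // adjmxE.
rewrite (_ : (fun p => _) = fun p : CV R n * measurableTypeR R =>
   dotc (evol H p.2 *m (p.1 : 'cV[R[i]]_n)) (B *m (evol H p.2 *m (p.1 : 'cV[R[i]]_n))) + (-1) * wmuB P H B p.2); last first.
  by apply/funext => p; rewrite mulN1r.
apply: cmeasD; last by apply: cmeasM => //; exact: cmeas_cst.
apply: (cmeas_dotc (A := fun p : CV R n * measurableTypeR R => evol H p.2 *m (p.1 : 'cV[R[i]]_n))) => // i.
apply: (cmeas_mulmx (A := fun p : CV R n * measurableTypeR R => B)) => [? ?|k l]; first exact: cmeas_cst.
by rewrite (ord1 l).
Qed.

Lemma measurable_dev_sqr : measurable_fun setT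
  (fun p : CV R n * measurableTypeR R => dev P H B p.1 p.2 ^+ 2).
Proof.
have := cmeas_csq cmeas_dev; congr measurable_fun.
by apply/funext => p; rewrite /dev cabsE.
Qed.

Lemma measurable_dev_sqr_at t : measurable_fun setT
  (fun x : CV R n => dev P H B x t ^+ 2).
Proof.
exact: (measurableT_comp measurable_dev_sqr (measurable_pair2 t)).
Qed.

Variable u : probability (CV R n) R.
Hypothesis unif : uniform_on_sphere P u.

Let mS : measurable S := measurable_sphere P.
Let uS : u S = 1%E := proj1 unif.

Lemma compressed_proj t : compressed t *m P = compressed t /\ P *m compressed t = compressed t.
Proof.
rewrite /compressed; move: (heisenberg t) => M.
by rewrite -!mulmxA (proj2 oP) [P *m (P *m _)]mulmxA (proj2 oP).
Qed.

Lemma dev_frames t : exists V1 l1 J1 V2 l2 J2,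
  [/\ frame P V1 J1 /\ frame P V2 J2,
      forall x : CV R n, S x -> dev P H B x t ^+ 2 = wdev V1 J1 l1 x ^+ 2 + wdev V2 J2 l2 x ^+ 2,
      \sum_(j in J1) l1 j ^+ 2 + \sum_(j in J2) l2 j ^+ 2 = hs (compressed t),
      forall j, j \in J1 -> `|l1 j| <= b &
      forall j, j \in J2 -> `|l2 j| <= b].
Proof.
have [XP PX] := compressed_proj t.
have [V1 [l1 [J1 [V2 [l2 [J2 [F D hsX bd]]]]]]] := deviation_frames oP XP PX.
have [b1 b2] := bd b opnorm_ge0 (@compressed_bound t).
exists V1, l1, J1, V2, l2, J2; split => // x [Px _].
by rewrite dev_sqr // -D.
Qed.

Lemma bmeas_dev_sqr t : bmeas S (fun x : CV R n => dev P H B x t ^+ 2).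
Proof.
split; first exact: measurable_dev_sqr_at.
have [V1 [l1 [J1 [V2 [l2 [J2 [[F1 F2] D _ _ _]]]]]]] := dev_frames t.
have [VV1 VV1' EP1 _] := F1; have [VV2 VV2' EP2 _] := F2.
have [_ [M hM]] := bmeasD (bmeasX 2 (bmeas_wdev VV1 VV1' EP1 l1)) (bmeasX 2 (bmeas_wdev VV2 VV2' EP2 l2)).
by exists M => x Sx; rewrite D // hM.
Qed.

Lemma dev_variance t : mean u S (fun x => dev P H B x t ^+ 2) <= hs (compressed t) / d ^+ 2.
Proof.
have [V1 [l1 [J1 [V2 [l2 [J2 [[F1 F2] D <- _ _]]]]]]] := dev_frames t.
have [VV1 VV1' EP1 c1] := F1; have [VV2 VV2' EP2 c2] := F2.
rewrite (eq_mean _ D) meanD //; last 2 first.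
- exact: bmeasX (bmeas_wdev VV1 VV1' EP1 l1).
- exact: bmeasX (bmeas_wdev VV2 VV2' EP2 l2).
rewrite mulrDl lerD //.
  by rewrite -c1; apply: (wdev_variance VV1 VV1' EP1 unif); rewrite c1.
by rewrite -c2; apply: (wdev_variance VV2 VV2' EP2 unif); rewrite c2.
Qed.

(** A modulus of at least [eta] forces one of the two real deviations to reach [eta / sqrt 2];
    adding their tails turns 2 into 4 and 24 into 48. *)
Lemma dev_tail t (eta : R) : 0 < b -> 0 <= eta ->
  (u (S `&` [set x : CV R n | (eta <= dev P H B x t)%R]) <=
    (4 * expR (- (eta ^+ 2 * d / (48 * b ^+ 2))))%:E)%E.
Proof.
move=> b0 eta0.
have [V1 [l1 [J1 [V2 [l2 [J2 [[F1 F2] D _ b1 b2]]]]]]] := dev_frames t.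
have [VV1 VV1' EP1 c1] := F1; have [VV2 VV2' EP2 c2] := F2.
pose eta' := Num.sqrt (eta ^+ 2 / 2).
have e0 : 0 <= eta' by exact: sqrtr_ge0.
have e2 : eta' ^+ 2 = eta ^+ 2 / 2 by rewrite sqr_sqrtr // divr_ge0 ?sqr_ge0.
have mset V J l (bf : bmeas S (wdev V J l)) : measurable (S `&` [set x | (eta' <= `|wdev V J l x|)%R]).
  apply: measurableI => //; rewrite -[X in measurable X]setTI.
  rewrite (_ : [set x | _] = (fun x => `|wdev V J l x|) @^-1` `[eta', +oo[).
    by apply: (measurableT_comp (@normr_measurable R setT) (proj1 bf)).
  by apply/seteqP; split => x /=; rewrite in_itv /= andbT.
have m1 := mset _ _ _ (bmeas_wdev VV1 VV1' EP1 l1).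
have m2 := mset _ _ _ (bmeas_wdev VV2 VV2' EP2 l2).
have md : measurable (S `&` [set x : CV R n | (eta <= dev P H B x t)%R]).
  apply: measurableI => //; rewrite -[X in measurable X]setTI.
  rewrite (_ : [set x | _] = (fun x : CV R n => dev P H B x t ^+ 2) @^-1` `[eta ^+ 2, +oo[).
    by apply: measurable_dev_sqr_at.
  by apply/seteqP; split => x /=; rewrite in_itv /= andbT ler_sqr ?nnegrE ?dev_ge0.
have t1 := wdev_tail VV1 VV1' EP1 unif _ b0 e0 b1.
have t2 := wdev_tail VV2 VV2' EP2 unif _ b0 e0 b2.
rewrite c1 in t1; rewrite c2 in t2.
have -> : (4 * expR (- (eta ^+ 2 * d / (48 * b ^+ 2))))%:E =
  ((2 * expR (- (eta' ^+ 2 * d / (24 * b ^+ 2))))%:E + (2 * expR (- (eta' ^+ 2 * d / (24 * b ^+ 2))))%:E)%E.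
  rewrite -EFinD; congr (_%:E); rewrite e2.
  have -> : eta ^+ 2 / 2 * d / (24 * b ^+ 2) = eta ^+ 2 * d / (48 * b ^+ 2) by field; rewrite gt_eqF.
  ring.
apply: le_trans (leeD (t1 P0) (t2 P0)).
apply: le_trans (measureU2 _ m1 m2); apply: le_measure; rewrite ?inE //; first exact: measurableU.
move=> x [Sx /= mean]; have := D x Sx.
have [h1|h1] := leP eta' `|wdev V1 J1 l1 x|; first by left.
have [h2|h2] := leP eta' `|wdev V2 J2 l2 x|; first by right.
move=> Dx; exfalso; have : eta ^+ 2 <= dev P H B x t ^+ 2 by rewrite ler_sqr ?nnegrE ?dev_ge0.
have g (f : R) : `|f| < eta' -> f ^+ 2 < eta ^+ 2 / 2.
  by move=> hf; rewrite -e2 -real_normK ?num_real // ltr_sqr ?nnegrE.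
by have := g _ h1; have := g _ h2; rewrite Dx; lra.
Qed.

End Deviation.

(** * The three bounds at a fixed time, and the time average *)

Section Typicality.
Variables (R : realType) (n : nat) (P H B : 'M[R[i]]_n).
Hypotheses (oP : orthoproj P) (P0 : (0 < \rank P)%N) (hH : selfadjoint H).
Variable u : probability (CV R n) R.
Hypothesis unif : uniform_on_sphere P u.
Local Notation d := ((\rank P)%:R : R).
Local Notation S := (sphere P : set (CV R n)).
Local Notation b := (opnorm B).

Let dgt0 : 0 < d. Proof. by rewrite ltr0n. Qed.
Let mS : measurable S := measurable_sphere P.
Let uS : u S = 1%E := proj1 unif.

Lemma dev_le_sqrt t (eps a : R) : 0 < eps -> 0 <= a ->
  hs (compressed P H B t) / d ^+ 2 <= eps * a ->
  ((1 - eps)%:E <= u [set x : CV R n | (dev P H B x t <= Num.sqrt a)%R])%E.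
Proof.
move=> e0 a0 h; have bd := bmeas_dev_sqr B oP P0 hH t.
have -> : [set x : CV R n | (dev P H B x t <= Num.sqrt a)%R] =
    [set x : CV R n | ((dev P H B x t ^+ 2)%:E <= a%:E)%E].
  apply/funext => x; apply/propext; rewrite /= lee_fin.
  by rewrite -[X in _ <-> is_true (_ <= X)](sqr_sqrtr a0) ler_sqr ?nnegrE ?dev_ge0 ?sqrtr_ge0.
apply: (markov_prob mS uS) => //.
- by apply/measurable_EFinP; exact: (proj1 bd).
- by move=> x; rewrite lee_fin sqr_ge0.
- rewrite -EFin_mean // lee_fin; apply: le_trans h; exact: dev_variance.
Qed.

Lemma dev_le_opnorm t (eps : R) : 0 < eps ->
  ((1 - eps)%:E <= u [set x : CV R n | (dev P H B x t <= b / Num.sqrt (eps * d))%R])%E.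
Proof.
move=> e0; have b0 := opnorm_ge0 B P0.
have ed : 0 < eps * d by rewrite mulr_gt0.
have -> : b / Num.sqrt (eps * d) = Num.sqrt (b ^+ 2 / (eps * d)).
  by rewrite [RHS]sqrtrM ?sqr_ge0 // sqrtr_sqr ger0_norm // sqrtrV // ltW.
apply: dev_le_sqrt => //; first by rewrite divr_ge0 ?sqr_ge0 // ltW.
have -> : eps * (b ^+ 2 / (eps * d)) = d * b ^+ 2 / d ^+ 2 by field; rewrite !gt_eqF.
by rewrite ler_wpM2r ?invr_ge0 ?sqr_ge0 // hs_compressed_le_rank.
Qed.

Lemma dev_le_trnorm t (eps : R) : 0 < eps ->
  ((1 - eps)%:E <= u [set x : CV R n | (dev P H B x t <= Num.sqrt (b * trnorm B / (eps * d ^+ 2)))%R])%E.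
Proof.
move=> e0; have b0 := opnorm_ge0 B P0; have t0 := trnorm_ge0 B.
apply: dev_le_sqrt => //; first by rewrite divr_ge0 ?mulr_ge0 ?sqr_ge0 // ltW.
have -> : eps * (b * trnorm B / (eps * d ^+ 2)) = b * trnorm B / d ^+ 2 by field; rewrite !gt_eqF.
by rewrite ler_wpM2r ?invr_ge0 ?sqr_ge0 // hs_compressed_le_trnorm.
Qed.

Lemma dev_le_levy t (eps : R) : 0 < eps -> eps < 1 ->
  ((1 - eps)%:E <= u [set x : CV R n | (dev P H B x t <=
     Num.sqrt (18 * pi ^+ 3 * ln (4 / eps) / d) * b)%R])%E.
Proof.
move=> e0 e1; have := opnorm_ge0 B P0; rewrite le_eqVlt => /predU1P[b0|b0].
  (* For [opnorm B = 0] the exponent of [dev_tail] is meaningless, but both bounds are 0 and the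
     variance bound applies. *)
  by have := dev_le_opnorm t e0; rewrite -b0 mul0r mulr0.
set L := ln (4 / eps).
have L0 : 0 <= L by apply: ln_ge0; rewrite ler_pdivlMr // mul1r; lra.
(* The tail only needs 48, and [2 <= pi] already gives 144. *)
have pi8 : 48 <= 18 * pi ^+ 3 :> R.
  have : (2 : R) ^+ 3 <= pi ^+ 3 by rewrite lerXn2r ?nnegrE ?pi_ge0 ?pi_ge2.
  by rewrite (_ : 2 ^+ 3 = 8 :> R); [lra|ring].
have q0 : 0 <= 18 * pi ^+ 3 * L / d by rewrite !mulr_ge0 ?invr_ge0 ?exprn_ge0 ?pi_ge0.
set eta := Num.sqrt _ * b.
have eta0 : 0 <= eta by rewrite mulr_ge0 ?sqrtr_ge0 // ltW.
apply: (prob_of_bad mS uS).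
  rewrite (_ : [set x | _] = (fun x : CV R n => dev P H B x t ^+ 2) @^-1` `]-oo, eta ^+ 2]).
    by rewrite -[X in measurable X]setTI; apply: measurable_dev_sqr_at.
  by apply/seteqP; split => x /=; rewrite in_itv /= ler_sqr ?nnegrE ?dev_ge0.
have := dev_tail oP P0 hH unif t b0 eta0.
have sub : S `&` ~` [set x : CV R n | (dev P H B x t <= eta)%R] `<=`
    S `&` [set x : CV R n | (eta <= dev P H B x t)%R].
  by move=> x [Sx /= /negP]; rewrite -ltNge => /ltW.
have md : measurable [set x : CV R n | (eta <= dev P H B x t)%R].
  rewrite (_ : [set x | _] = (fun x : CV R n => dev P H B x t ^+ 2) @^-1` `[eta ^+ 2, +oo[).
    by rewrite -[X in measurable X]setTI; apply: measurable_dev_sqr_at.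
  by apply/seteqP; split => x /=; rewrite in_itv /= andbT ler_sqr ?nnegrE ?dev_ge0.
have md' : measurable [set x : CV R n | (dev P H B x t <= eta)%R].
  rewrite (_ : [set x | _] = (fun x : CV R n => dev P H B x t ^+ 2) @^-1` `]-oo, eta ^+ 2]).
    by rewrite -[X in measurable X]setTI; apply: measurable_dev_sqr_at.
  by apply/seteqP; split => x /=; rewrite in_itv /= ler_sqr ?nnegrE ?dev_ge0.
move=> tail; apply: le_trans (le_trans (le_measure _ _ _ sub) tail) _; rewrite ?inE.
- by apply: measurableI => //; exact: measurableC.
- exact: measurableI.
(* The exponent is at least [L], and [4 * expR (- L)] equals [eps]. *)
have E : eta ^+ 2 * d / (48 * b ^+ 2) = (18 * pi ^+ 3 / 48) * L.
  by rewrite exprMn sqr_sqrtr //; field; rewrite !gt_eqF.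
rewrite lee_fin E; apply: (@le_trans _ _ (4 * expR (- L))).
  rewrite ler_wpM2l // ler_expR lerN2 ler_peMl // ler_pdivlMr // mul1r //.
by rewrite expRN lnK ?posrE ?divr_gt0 // invf_div mulrCA divff ?mulr1.
Qed.

Lemma dev_time_average (T eps : R) : 0 < T -> 0 < eps ->
  ((1 - eps)%:E <= u [set x : CV R n |
     (T^-1%:E * \int[@lebesgue_measure R]_(t in `[0%R, T]) ((dev P H B x t) ^+ 2)%R%:E
        <= (b ^+ 2 / (eps * d))%R%:E)%E])%E.
Proof.
move=> T0 e0; have ed : 0 < eps * d by rewrite mulr_gt0.
set I : set R := `[0, T]%classic.
have mI : measurable (I : set (measurableTypeR R)) by exact: measurable_itv.
(* [D = setT] yields measurability of the time integral on the whole space, [D = S] the exchange of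
   integrals. *)
pose g D (p : CV R n * measurableTypeR R) : \bar R :=
  (dev P H B p.1 p.2 ^+ 2 * (\1_D p.1 * \1_I p.2))%:E.
have g0 D p : (0 <= g D p)%E.
  by rewrite lee_fin mulr_ge0 ?sqr_ge0 // mulr_ge0 // indicE.
have mg D : measurable D -> measurable_fun setT (g D).
  move=> mD; apply/measurable_EFinP; apply: measurable_funM; first exact: measurable_dev_sqr.
  apply: measurable_funM.
    exact: (measurableT_comp (measurable_indic mD) measurable_fst).
  exact: (measurableT_comp (measurable_indic mI) measurable_snd).
pose F (x : CV R n) : \bar R := (\int[@lebesgue_measure R]_(t in I) ((dev P H B x t) ^+ 2)%R%:E)%E.
have gF D x : (\int[@lebesgue_measure R]_t g D (x, t))%E = ((F \_ D) x)%E.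
  rewrite patchE; case: ifPn => xD.
    rewrite /F [RHS]integral_mkcond; apply: eq_integral => t _.
    by rewrite /g /= !indicE xD mul1r patchE; case: ifP; rewrite ?mulr1 ?mulr0.
  by rewrite integral0_eq // => t _; rewrite /g /= [\1_D x]indicE (negbTE xD) mul0r mulr0.
have mF : measurable_fun setT F.
  have := measurable_fun_fubini_tonelli_F (m2 := @lebesgue_measure R) (g setT) (mg setT measurableT) (g0 setT).
  by congr measurable_fun; apply/funext => x; rewrite /fubini_F gF patch_setT.
have F0 x : (0 <= F x)%E by apply: integral_ge0 => t _; rewrite lee_fin sqr_ge0.
apply: (markov_prob mS uS (f := fun x => (T^-1%:E * F x)%E)) => //.
- exact: measurable_funeM.
- by move=> x; rewrite mule_ge0 // lee_fin invr_ge0 ltW.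
- by rewrite divr_ge0 ?sqr_ge0 // ltW.
rewrite ge0_integralZl //; last 2 first.
- exact: measurable_funS mF.
- by rewrite lee_fin invr_ge0 ltW.
have -> : (\int[u]_(x in S) F x = \int[@lebesgue_measure R]_(t in I) (mean u S (fun x => dev P H B x t ^+ 2))%:E)%E.
  rewrite integral_mkcond; under eq_integral do rewrite -gF.
  rewrite (fubini_tonelli (g S) (mg S mS) (g0 S)) [RHS]integral_mkcond; apply: eq_integral => t _.
  rewrite patchE; case: ifPn => tI.
    rewrite EFin_mean //; last exact: bmeas_dev_sqr.
    rewrite [RHS]integral_mkcond; apply: eq_integral => x _.
    by rewrite /g /= !indicE tI mulr1 patchE; case: ifP; rewrite ?mulr1 ?mulr0.
  by rewrite integral0_eq // => x _; rewrite /g /= [\1_I t]indicE (negbTE tI) !mulr0.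
have mex : measurable_fun I (fun t : measurableTypeR R => (mean u S (fun x => dev P H B x t ^+ 2))%:E).
  have := measurable_fun_fubini_tonelli_G (m1 := u) (g S) (mg S mS) (g0 S).
  move=> /(measurable_funS measurableT (subsetT I)); apply: eq_measurable_fun => t /[!inE] It.
  transitivity (\int[u]_(x in S) (dev P H B x t ^+ 2)%:E)%E; last by rewrite -EFin_mean //; exact: bmeas_dev_sqr.
  rewrite [RHS]integral_mkcond /fubini_G.
  apply: eq_integral => x _.
  by rewrite /g /= !indicE (mem_set It) mulr1 patchE; case: ifP; rewrite ?mulr1 ?mulr0.
(* The variance bound is uniform in [t], so averaging over time preserves it. *)
apply: (@le_trans _ _ (T^-1%:E * \int[@lebesgue_measure R]_(t in I) (cst (b ^+ 2 / d)%:E t))%E).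
  rewrite lee_pmul2l ?lte_fin ?invr_gt0 //.
  apply: ge0_le_integral => //.
  - by move=> t _; rewrite lee_fin Rintegral_ge0 // => x _; rewrite sqr_ge0.
  - move=> t _; rewrite /= lee_fin; apply: (le_trans (dev_variance B oP P0 hH unif t)).
    have -> : b ^+ 2 / d = d * b ^+ 2 / d ^+ 2 by field; rewrite gt_eqF.
    by rewrite ler_wpM2r ?invr_ge0 ?sqr_ge0 // hs_compressed_le_rank.
have lI : @lebesgue_measure R I = T%:E.
  by rewrite lebesgue_measure_itv /= lte_fin T0 oppr0 adde0.
rewrite integral_cst // -[X in (_ * (_ * X))%E]/(@lebesgue_measure R I) lI -!EFinM lee_fin.
by rewrite le_eqVlt; apply/predU1P; left; field; rewrite !gt_eqF.
Qed.

End Typicality.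

Theorem theorem3 (R : realType) (n : nat) (P H B : 'M[R[i]]_n)
    (u : probability (CV R n) R) :
  orthoproj P -> (0 < \rank P)%N -> selfadjoint H -> uniform_on_sphere P u ->
  (forall (t eps : R), 0 < eps ->
     (((1 - eps)%R)%:E <= u [set psi0 : 'cV[R[i]]_n |
        (dev P H B psi0 t <=
          Num.min (opnorm B / Num.sqrt (eps * (\rank P)%:R))
         (Num.min (Num.sqrt (opnorm B * trnorm B / (eps * (\rank P)%:R ^+ 2)))
                  (Num.sqrt (18 * pi ^+ 3 * ln (4 / eps) / (\rank P)%:R) * opnorm B)))%R])%E)
  /\
  (forall (T eps : R), 0 < T -> 0 < eps ->
     (((1 - eps)%R)%:E <= u [set psi0 : 'cV[R[i]]_n |
        (T^-1)%R%:E * (\int[@lebesgue_measure R]_(t in `[0%R, T]) ((dev P H B psi0 t) ^+ 2)%R%:E)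
          <= ((opnorm B ^+ 2 / (eps * (\rank P)%:R))%R)%:E])%E).
Proof.
move=> oP P0 hH unif; split => [t eps e0|T eps T0 e0]; last exact: dev_time_average.
(* For [eps >= 1] the required probability is at most 0; otherwise [ln (4 / eps)] is positive, as
   [dev_le_levy] needs. *)
have [e1|e1] := ltP eps 1; last by rewrite (@le_trans _ _ 0%E) // lee_fin subr_le0.
rewrite /Num.min; case: ifP => _; first exact: dev_le_opnorm.
by case: ifP => _; [exact: dev_le_trnorm|exact: dev_le_levy].
Qed.
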